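(* Any maximal Gromov product space $X$ is a (pointed) Gromov-Hausdorff limit of a sequence of finite dimensional $l_\infty$-polyhedral complexes $X_n$ which are maximal Gromov product (hyperbolic) spaces with finite boundary; that is, there exist such $X_n$ and base points $x_n\in X_n$, $x\in X$ with $(X_n,x_n)\to(X,x)$ in the pointed Gromov-Hausdorff sense. In particular, any injective, good Gromov hyperbolic space is a (pointed) Gromov-Hausdorff limit of finite dimensional $l_\infty$-polyhedral complexes.
   Context: **Semi-metric and antipodal spaces.** A compact semi-metric space $(Z,\rho)$ is a compact metrizable space $Z$ with at least four points together with a continuous symmetric function $\rho:Z\times Z\to[0,\infty)$ with $\rho(\xi,\eta)=0$ iff $\xi=\eta$. It is an antipodal space if moreover $\sup_{\xi,\eta}\rho(\xi,\eta)=1$ and for every $\xi\in Z$ there is $\eta\in Z$ with $\rho(\xi,\eta)=1$. The cross-ratio is $[\xi,\xi',\eta,\eta']_\rho=\frac{\rho(\xi,\eta)\rho(\xi',\eta')}{\rho(\xi,\eta')\rho(\xi',\eta)}$ for distinct points; a Moebius homeomorphism is a homeomorphism preserving cross-ratios. **Gromov product spaces.** In a metric space $X$, $(y|z)_x=\frac12(d(y,x)+d(z,x)-d(y,z))$. A Gromov product space is a proper, geodesic, geodesically complete (every geodesic segment extends to a bi-infinite geodesic) metric space $X$ having a second countable Hausdorff compactification $\hat X$ such that for every $x\in X$ the Gromov product $(\cdot|\cdot)_x$ extends to a continuous function $\hat X\times\hat X\to[0,+\infty]$ and, for $\xi,\eta\in\hat X\setminus X$, $(\xi|\eta)_x=+\infty$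 iff $\xi=\eta$. The compactification is unique up to equivalence; $\partial_P X=\hat X\setminus X$ is the Gromov product boundary (''boundary''). For $x\in X$, $\rho_x=\exp(-(\cdot|\cdot)_x)$ on $\partial_P X$; $(\partial_P X,\rho_x)$ is an antipodal space (boundaries are understood to have at least four points), and the cross-ratio of $\rho_x$ does not depend on $x$. $X$ is a maximal Gromov product space if for every Gromov product space $Y$ and every Moebius homeomorphism $g:\partial_P Y\to\partial_P X$, $g$ extends to an isometric embedding $Y\to X$. ''(Hyperbolic)'' means that the spaces $X_n$ are also Gromov hyperbolic. A good Gromov hyperbolic space is a Gromov hyperbolic space that is proper, geodesic, geodesically complete and boundary continuous (the Gromov product extends continuously to the Gromov boundary). A metric space $X$ is injective if every $1$-Lipschitz map from a subspace $B$ of a metric space $A$ to $X$ extends to a $1$-Lipschitz map $A\to X$. **$l_\infty$-polyhedral complexes.** A finite dimensional $l_\infty$-polyhedral complex is a metric space isometric to a subset of some $(\mathbb{R}^m,\|\cdot\|_\infty)$, with the restricted metric, which is the union of a finite collection of (possibly unbounded) convex polyhedra forming a polyhedral complex (closed under taking faces, any two meeting in a common face or not at all). **Pointed Gromov-Hausdorff convergence.** A map $f:X\to Y$ of metric spaces (not necessarily continuous) is an $\epsilon$-isometry if $\sup_{x_1,x_2}|d_Y(f(x_1),f(x_2))-d_X(x_1,x_2)|<\epsilon$ and $Y=\bigcup_{x\in X}B_Y(f(x),\epsilon)$. For pointed proper geodesic metric spaces, $(X_n,p_n)\to(X,p)$ means: for every $R>0$ and $\epsilon>0$ there is $n_0$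 such that for all $n\ge n_0$ there is an $\epsilon$-isometry $f:B_{X_n}(p_n,R)\to B_X(p,R)$ with $f(p_n)=p$. Balls $B_X(p,R)$ are closed. *)

(* Defs.v *)
From HB Require Import structures.
From mathcomp Require Import all_boot all_order all_algebra.
From mathcomp Require Import all_classical all_reals all_analysis.
Set Implicit Arguments.
Unset Strict Implicit.
Unset Printing Implicit Defensive.
Import Order.TTheory GRing.Theory Num.Theory.
Import numFieldNormedType.Exports.
Local Open Scope classical_set_scope.
Local Open Scope ring_scope.

Section MetricSpaces.
Context {R : realType}.

Definition cball (X : metricType R) (x : X) (r : R) : set X :=
  [set y | mdist x y <= r].

Definition isometric_embedding (X Y : metricType R) (f : X -> Y) :=
  forall x y, mdist (f x) (f y) = mdist x y.

Definition proper_space (X : metricType R) :=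
  forall (x : X) (r : R), compact (cball x r).

(* A geodesic on an interval is an isometric embedding of that interval; it is
   represented by a total function whose values outside [D] are irrelevant. *)
Definition geodesic_on (X : metricType R) (D : set R) (c : R -> X) :=
  {in D &, forall s t, mdist (c s) (c t) = `|s - t|}.

Definition geodesic_space (X : metricType R) :=
  forall x y : X, exists c : R -> X,
    [/\ geodesic_on `[0, mdist x y] c, c 0 = x & c (mdist x y) = y].

Definition geodesically_complete (X : metricType R) :=
  forall (a b : R) (c : R -> X), a <= b -> geodesic_on `[a, b] c ->
    exists c' : R -> X, geodesic_on setT c' /\ {in `[a, b], c' =1 c}.

Definition gromov_product (X : metricType R) (x y z : X) : R :=
  (mdist y x + mdist z x - mdist y z) / 2.

Definition gromov_hyperbolic (X : metricType R) :=
  exists2 delta : R, 0 <= delta &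
    forall w x y z : X,
      Num.min (gromov_product w x y) (gromov_product w y z) - delta
        <= gromov_product w x z.

Definition injective_space (X : metricType R) :=
  forall (A : metricType R) (B : set A) (f : B -> X),
    (forall b b' : B, mdist (f b) (f b') <= mdist (val b) (val b')) ->
    exists F : A -> X, (forall a a', mdist (F a) (F a') <= mdist a a') /\
                       (forall b : B, F (val b) = f b).

End MetricSpaces.

(* The extended products [gp_ext x] and the compactification [gp_hat] are part
   of the data; the first are determined by continuity and density, the second
   is unique up to equivalence. *)
Record gp_space (R : realType) := GPSpace {
  gp_metric :> metricType R;
  gp_hat : topologicalType;
  gp_emb : gp_metric -> gp_hat;
  gp_ext : gp_metric -> gp_hat -> gp_hat -> \bar R;
  gp_proper : proper_space gp_metric;
  gp_geodesic : geodesic_space gp_metric;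
  gp_complete : geodesically_complete gp_metric;
  gp_hat_compact : compact [set: gp_hat];
  gp_hat_hausdorff : hausdorff_space gp_hat;
  gp_hat_second_countable : @second_countable gp_hat;
  gp_emb_inj : injective gp_emb;
  gp_emb_open : forall U : set gp_metric,
    open U <-> exists2 V : set gp_hat, open V & gp_emb @^-1` V = U;
  gp_emb_dense : dense (range gp_emb);
  gp_ext_emb : forall x y z : gp_metric,
    gp_ext x (gp_emb y) (gp_emb z) = (gromov_product x y z)%:E;
  gp_ext_ge0 : forall x p q, (0 <= gp_ext x p q)%E;
  gp_ext_continuous : forall x,
    continuous (fun pq : gp_hat * gp_hat => gp_ext x pq.1 pq.2);
  gp_ext_oo : forall x p q, ~ range gp_emb p -> ~ range gp_emb q ->
    (gp_ext x p q = +oo%E <-> p = q);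
  gp_four_points : (`I_4 #<= ~` range gp_emb)%card
}.

Arguments gp_hat {R} g.
Arguments gp_emb {R g}.
Arguments gp_ext {R g}.

(* A subset seen as a type carries the subspace topology. *)
Definition gp_boundary (R : realType) (X : gp_space R) : topologicalType :=
  set_type (~` range (@gp_emb R X)).

Definition cross_ratio (R : realType) (Z : Type) (rho : Z -> Z -> R)
    (xi xi' eta eta' : Z) : R :=
  (rho xi eta * rho xi' eta') / (rho xi eta' * rho xi' eta).

Definition homeomorphism (Z W : topologicalType) (g : Z -> W) :=
  exists h : W -> Z, [/\ cancel g h, cancel h g, continuous g & continuous h].

Definition moebius_homeomorphism (R : realType) (Z W : topologicalType)
    (rho : Z -> Z -> R) (sigma : W -> W -> R) (g : Z -> W) :=
  homeomorphism g /\
  forall xi xi' eta eta' : Z, uniq [:: xi; xi'; eta; eta'] ->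
    cross_ratio sigma (g xi) (g xi') (g eta) (g eta') =
    cross_ratio rho xi xi' eta eta'.

Section GromovProductSpaces.
Context {R : realType}.

Definition visual (X : gp_space R) (x : X) (xi eta : gp_boundary X) : R :=
  fine (expeR (- gp_ext x (val xi) (val eta))).

Definition boundary_moebius (Y X : gp_space R)
    (g : gp_boundary Y -> gp_boundary X) :=
  forall (y : Y) (x : X), moebius_homeomorphism (visual y) (visual x) g.

(* [g] extends to [F]: [F] and [g] glue to a continuous map between the
   compactifications. *)
Definition boundary_extends_to (Y X : gp_space R)
    (g : gp_boundary Y -> gp_boundary X) (F : Y -> X) :=
  exists Fhat : gp_hat Y -> gp_hat X,
    [/\ continuous Fhat,
        forall y, Fhat (gp_emb y) = gp_emb (F y) &
        forall xi, Fhat (val xi) = val (g xi)].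

Definition maximal_gp_space (X : gp_space R) :=
  forall (Y : gp_space R) (g : gp_boundary Y -> gp_boundary X),
    boundary_moebius g ->
    exists2 F : Y -> X, isometric_embedding F & boundary_extends_to g F.

End GromovProductSpaces.

Section PolyhedralComplexes.
Context {R : realType}.

Definition dotv (m : nat) (a x : 'rV[R]_m) : R := \sum_(j < m) a 0 j * x 0 j.

Definition convex_polyhedron (m : nat) (P : set 'rV[R]_m) :=
  exists (k : nat) (a : 'I_k -> 'rV[R]_m) (b : 'I_k -> R),
    P = [set x | forall i, dotv (a i) x <= b i].

(* Intersections with supporting hyperplanes; [a = 0] gives [P] itself (and the
   empty face). *)
Definition face (m : nat) (F P : set 'rV[R]_m) :=
  exists (a : 'rV[R]_m) (b : R),
    P `<=` [set x | dotv a x <= b] /\ F = P `&` [set x | dotv a x = b].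

Definition polyhedral_complex (m : nat) (K : set (set 'rV[R]_m)) :=
  [/\ finite_set K,
      forall P, K P -> convex_polyhedron P /\ P !=set0,
      forall P F, K P -> face F P -> F !=set0 -> K F &
      forall P Q, K P -> K Q -> P `&` Q !=set0 ->
        face (P `&` Q) P /\ face (P `&` Q) Q].

(* The library norm on row vectors is the maximum norm. *)
Definition linf_polyhedral_complex (X : metricType R) :=
  exists (m : nat) (K : set (set 'rV[R]_m)) (f : X -> 'rV[R]_m),
    [/\ polyhedral_complex K,
        forall x y, `|f x - f y| = mdist x y &
        range f = \bigcup_(P in K) P].

End PolyhedralComplexes.

Section PointedGromovHausdorff.
Context {R : realType}.

(* An [eps]-isometry from the subspace [A] to the subspace [B], given by a total
   function whose values outside [A] are irrelevant. *)
Definition eps_isometry (X Y : metricType R) (A : set X) (B : set Y)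
    (eps : R) (f : X -> Y) :=
  [/\ forall x, A x -> B (f x),
      (ereal_sup [set (`|mdist (f x1) (f x2) - mdist x1 x2|)%:E
                 | x1 in A & x2 in A] < eps%:E)%E &
      B `<=` \bigcup_(x in A) cball (f x) eps].

Definition pointed_gh_cvg (X_ : nat -> metricType R) (p_ : forall n, X_ n)
    (X : metricType R) (p : X) :=
  [/\ forall n, proper_space (X_ n) /\ geodesic_space (X_ n),
      proper_space X /\ geodesic_space X &
      forall r eps : R, 0 < r -> 0 < eps ->
        exists n0 : nat, forall n, (n0 <= n)%N ->
          exists2 f : X_ n -> X,
            eps_isometry (cball (p_ n) r) (cball p r) eps f & f (p_ n) = p].

End PointedGromovHausdorff.

Section GromovBoundary.
Context {R : realType} (X : metricType R).

(* The Gromov boundary as classes of sequences converging to infinity. None of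
   these notions depends on the base point [o]. *)
Definition converges_to_infinity (u : nat -> X) :=
  forall o : X,
    gromov_product o (u ij.1) (u ij.2) @[ij --> filter_prod \oo \oo] --> +oo.

Definition gromov_equiv (u v : nat -> X) :=
  forall o : X, gromov_product o (u i) (v i) @[i --> \oo] --> +oo.

Definition gromov_class (u : nat -> X) : set (nat -> X) :=
  [set v | converges_to_infinity v /\ gromov_equiv u v].

Definition gromov_boundary : Type :=
  set_type [set c | exists2 u, converges_to_infinity u & c = gromov_class u].

Inductive gromov_bordification : Type :=
  | Inner of X
  | Ideal of gromov_boundary.

Definition approaching (p : gromov_bordification) : set (nat -> X) :=
  match p with
  | Inner x => [set u | u @ \oo --> x]
  | Ideal xi => val xi
  end.

(* sup liminf (u_i | v_j)_o over all sequences u -> p and v -> q: the usual,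
   possibly discontinuous, extension of the Gromov product, which serves only to
   define neighborhoods of the ideal points. *)
Definition extended_product (o : X) (p q : gromov_bordification) : \bar R :=
  ereal_sup
    [set limf_einf (fun ij : nat * nat =>
           (gromov_product o (u ij.1) (v ij.2))%:E) (filter_prod \oo \oo)
    | u in approaching p & v in approaching q].

(* In a hyperbolic space the sets {p | (p | xi)_o > r} form a (not necessarily
   open) neighborhood base at the ideal point xi. *)
Definition bordification_open (U : set gromov_bordification) :=
  open (Inner @^-1` U) /\
  forall xi, U (Ideal xi) -> forall o, exists r : R,
    [set p | (r%:E < extended_product o p (Ideal xi))%E] `<=` U.

Lemma bordification_openT : bordification_open setT.
Proof.
by split=> [|xi _ o]; [exact: openT | exists 0].
Qed.

Lemma bordification_openI : setI_closed bordification_open.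
Proof.
move=> U V [oU hU] [oV hV]; split; first by rewrite preimage_setI; exact: openI.
move=> xi [Ux Vx] o; have [r rU] := hU _ Ux o; have [s sV] := hV _ Vx o.
exists (Num.max r s) => p /=.
by rewrite EFin_max gt_max => /andP[rp sp]; split; [exact: rU | exact: sV].
Qed.

Lemma bordification_open_bigU (I : Type) (f : I -> set gromov_bordification) :
  (forall i, bordification_open (f i)) -> bordification_open (\bigcup_i f i).
Proof.
move=> hf; split.
  by rewrite preimage_bigcup; apply: bigcup_open => i _; have [] := hf i.
move=> xi [i _ fxi] o; have [_ /(_ _ fxi o) [r rf]] := hf i.
by exists r => p /rf fp; exists i.
Qed.

HB.instance Definition _ := gen_eqMixin gromov_bordification.
HB.instance Definition _ := gen_choiceMixin gromov_bordification.
HB.instance Definition _ := isOpenTopological.Build gromov_bordification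
  bordification_openT bordification_openI bordification_open_bigU.

Definition boundary_continuous :=
  forall x : X, exists E : gromov_bordification * gromov_bordification -> \bar R,
    [/\ continuous E,
        forall pq, (0 <= E pq)%E &
        forall y z, E (Inner y, Inner z) = (gromov_product x y z)%:E].

Definition good_gromov_hyperbolic :=
  [/\ gromov_hyperbolic X, proper_space X, geodesic_space X,
      geodesically_complete X & boundary_continuous].

End GromovBoundary.

(* Main.v *)
(* Let X be a maximal Gromov product space with boundary Z and let
   rho = exp (- (.|.)_o). The antipodal functions which are Moebius equivalent to
   rho are the functions rho(x, y) exp ((f x + f y) / 2) where f satisfies
   f x + f y <= - 2 ln rho(x, y), with equality for some y for every x. With the
   sup metric these f form a space T(Z): a tight span in which the diagonal
   imposes no constraint. Iterating f |-> (f + f') / 2, where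
   f' x = inf_y (- 2 ln rho(x, y) - f y), gives a 1-Lipschitz retraction onto
   T(Z), whence geodesics, and rays to every boundary point. Adding to T(Z) the
   points of Z, and comparing points p by the functions exp (- (p|.)_o) on Z,
   makes T(Z) a Gromov product space with boundary Z, so that the maximality of X
   identifies X with T(Z).

   Let Z_n be a finite net in Z containing an antipode of each of its points.
   Then T(Z_n) is polyhedral and hyperbolic, and it is maximal because every Y
   with boundary Z_n maps to it by logarithmic densities. Extending a function
   on Z_n by the constant - |f| and retracting embeds T(Z_n) isometrically in
   T(Z), with images that become dense in bounded sets: this is the required
   convergence.

   For an injective proper space X one uses instead the tight spans of finite
   nets of balls, which embed in X by injectivity. *)
Require Import Defs.
From HB Require Import structures.
From mathcomp Require Import all_boot all_order all_algebra.
From mathcomp Require Import all_classical all_reals all_analysis.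
From mathcomp Require Import ring lra.
Set Implicit Arguments.
Unset Strict Implicit.
Unset Printing Implicit Defensive.
Import Order.TTheory GRing.Theory Num.Theory.
Import numFieldNormedType.Exports.
Local Open Scope classical_set_scope.
Local Open Scope ring_scope.


(** Maximality of X only yields maps into X from spaces with the same boundary, whereas a finite net
    has another boundary. This is why X is replaced by the explicit space T(Z), in which functions
    given on a net can be extended and retracted. The sup metric is the right one because the
    logarithmic density of exp (- (.|.)_x) with respect to exp (- (.|.)_o) is a Busemann function,
    and suprema of differences of Busemann functions recover distances as soon as geodesics extend
    to infinity. The retraction averages f and f' because f' need not be admissible, while the
    average always is; being canonical, it is Lipschitz. Maximality is proved only for finite
    boundaries, where a Moebius factor is automatically bounded and the continuity of the extended
    map involves finitely many coordinates. *)

(** * Ultrafilters, compactness and finite covers *)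

Lemma ultra_fmap (T U : Type) (f : T -> U) (F : set_system T) :
  UltraFilter F -> UltraFilter (f @ F).
Proof.
move=> UF; split; first exact: fmap_proper_filter.
move=> G PG FG; apply/seteqP; split => // A GA.
have [//|FnA] := in_ultra_setVsetC (f @^-1` A) UF.
have : G (A `&` ~` A) by apply: filterI => //; exact: FG.
by rewrite setICr => /(@filter_not_empty _ _ _).
Qed.

Lemma ultra_cvg_compact (T : Type) (U : topologicalType) (f : T -> U)
    (F : set_system T) (A : set U) : UltraFilter F ->
  compact A -> F (f @^-1` A) -> exists2 l, A l & f @ F --> l.
Proof.
by move=> /(ultra_fmap f) UF; rewrite compact_ultra => /(_ _ UF) h /h [l [? ?]]; exists l.
Qed.

(** If no finite family covered [D], the complements in [D] of finite unions of the sets [U a] would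
    form a filter base, and an ultrafilter refining it would contradict the hypothesis. The
    prescribed point at [ord0] later keeps the base point in the nets. *)
Lemma ultra_finite_cover (T : Type) (D : set T) (U : T -> T -> Prop) (p : T) :
  (forall F : set_system T, UltraFilter F -> F D -> exists x, F [set y | U x y]) ->
  exists m (b : 'I_m.+1 -> T), b ord0 = p /\
    forall y, D y -> exists i, U (b i) y.
Proof.
move=> hU; apply: contrapT => hn.
pose B (s : seq T) := [set y | D y /\ forall a, List.In a s -> ~ U a y].
have PF : ProperFilter (filter_from setT B).
  apply: filter_from_proper.
    apply: filter_from_filter; first by exists [::].
    move=> s t _ _; exists (s ++ t) => // x [Dx hx]; split; split=> // a ha;
      apply: hx; apply: List.in_or_app; by [left|right].
  move=> s _; apply: contrapT => Bs; apply: hn.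
  exists (size s), (fun i => nth p (p :: s) i); split=> // y Dy.
  have : ~ forall a, List.In a s -> ~ U a y by move=> h; apply: Bs; exists y.
  move=> /existsNP[a /not_implyP[ha /contrapT Ua]].
  have [n [ns na]] : exists n, (n < size s)%N /\ nth p s n = a.
    elim: s ha {Bs} => //= b s ih [<-|/ih[n [ns na]]]; first by exists 0%N.
    by exists n.+1.
  by exists (@Ordinal (size s).+1 n.+1 ns); rewrite /= na.
have [G [UG FG]] := ultraFilterLemma PF.
have GD : G D by apply: FG; exists [::] => // y [].
have [x Gx] := hU G UG GD.
have G1 : G (B [:: x]) by apply: FG; exists [:: x].
have [y /= [[_ h1] h2]] := filter_ex (filterI G1 Gx).
by have := h1 x (or_introl erefl).
Qed.

(** * Neighborhoods and continuity in terms of distances *)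

Section MetricFacts.
Context {R : realType} (X : metricType R).
Implicit Types (x y : X) (e : R).

Lemma nbhs_mdist x e : 0 < e -> nbhs x [set y | mdist x y < e].
Proof.
by move=> e0; apply/metricType_numDomainType.nbhs_mdistP; exists e.
Qed.

Lemma nbhs_mdist_ex x (A : set X) : nbhs x A ->
  exists2 e : R, 0 < e & forall y, mdist x y < e -> A y.
Proof. by move=> /metricType_numDomainType.nbhs_mdistP[e e0 h]; exists e. Qed.

Lemma open_mdist x e : open [set y | mdist x y < e].
Proof.
rewrite openE => y /= xy; have e0 : 0 < e - mdist x y by lra.
by apply: filterS (nbhs_mdist y e0) => z /=; have := metric_triangle x y z; lra.
Qed.

Lemma cvg_mdist (T : Type) (F : set_system T) (FF : Filter F) (f : T -> X) x :
  (forall e, 0 < e -> F [set t | mdist x (f t) < e]) -> f @ F --> x.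
Proof. by move=> h; apply/metricType_numDomainType.cvgrPdist_lt. Qed.

Lemma cvg_mdist_lt (T : Type) (F : set_system T) (FF : Filter F) (f : T -> X) x e :
  f @ F --> x -> 0 < e -> F [set t | mdist x (f t) < e].
Proof. by move=> h e0; exact: h (nbhs_mdist x e0). Qed.

End MetricFacts.

Section MetricContinuity.
Context {R : realType} (X : metricType R).
Implicit Types (x y : X) (e : R).

Lemma continuous_mdist (Y : metricType R) (f : X -> Y) :
  (forall x e, 0 < e -> exists2 d, 0 < d &
    forall y, mdist x y < d -> mdist (f x) (f y) < e) -> continuous f.
Proof.
move=> h x; apply: (@cvg_mdist R Y X (nbhs x) _) => e /(h x)[d d0 hd].
exact: filterS (nbhs_mdist x d0).
Qed.

Lemma continuous_mdistR (f : X -> R) :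
  (forall x e, 0 < e -> exists2 d, 0 < d &
    forall y, mdist x y < d -> `|f x - f y| < e) -> continuous f.
Proof.
move=> h x; apply/(@cvgrPdist_lt _ _ X (nbhs x) _) => e /(h x)[d d0 hd].
exact: filterS (nbhs_mdist x d0).
Qed.

End MetricContinuity.

(** * The sup distance between bounded functions *)

Section SupDistance.
Context {R : realType} {X : Type}.
Implicit Types (f g h : X -> R).

Definition bounded f := exists M : R, forall x, `|f x| <= M.

Definition supd f g : R := sup (range (fun x => `|f x - g x|)).

Lemma supd_ge f g x : bounded f -> bounded g -> `|f x - g x| <= supd f g.
Proof.
move=> [M fM] [N gN]; apply: ub_le_sup; last by exists x.
by exists (M + N) => _ [y _ <-]; rewrite (le_trans (ler_normB _ _))// lerD.
Qed.

Lemma supd_le (x0 : X) f g c : (forall x, `|f x - g x| <= c) -> supd f g <= c.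
Proof.
move=> h; apply: ge_sup; first by exists `|f x0 - g x0|, x0.
by move=> _ [x _ <-].
Qed.

Lemma supdxx (x0 : X) f : bounded f -> supd f f = 0.
Proof.
move=> bf; apply/eqP; rewrite eq_le (le_trans _ (supd_ge x0 bf bf))//.
by rewrite andbT; apply: (supd_le x0) => x; rewrite subrr normr0.
Qed.

Lemma supd_eq0 f g : bounded f -> bounded g -> supd f g = 0 -> f =1 g.
Proof.
move=> bf bg fg x; apply/eqP; rewrite -subr_eq0 -normr_le0 -fg.
exact: supd_ge.
Qed.

Lemma supdC f g : supd f g = supd g f.
Proof. by congr sup; congr image; apply/funext => x; rewrite distrC. Qed.

Lemma supd_triangle (x0 : X) g f h : bounded f -> bounded g -> bounded h ->
  supd f h <= supd f g + supd g h.
Proof.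
move=> bf bg bh; apply: (supd_le x0) => x; rewrite -(subrKA (g x)).
by rewrite (le_trans (ler_normD _ _))// lerD// supd_ge.
Qed.

End SupDistance.

(** * Tight spans and their 1-Lipschitz retraction *)

(* The points of the span are the functions [f] with [f x + f y <= sd_cap x y]
   whenever [sd_edge x y], tight at every [x]. For [sd_edge := True] and
   [sd_cap := - d] these are the negatives of the elements of the tight span of
   the metric [d]; for [sd_edge x y := x <> y] and [sd_cap := - 2 ln rho] they
   are the logarithmic densities of the antipodal functions which are Moebius
   equivalent to [rho]. *)
Record span_data (R : realType) := SpanData {
  sd_pt :> Type;
  sd_edge : sd_pt -> sd_pt -> Prop;
  sd_cap : sd_pt -> sd_pt -> R;
  sd_edgeC : forall x y, sd_edge x y -> sd_edge y x;
  sd_capC : forall x y, sd_cap x y = sd_cap y x;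
  sd_cap_le0 : forall x, exists2 y, sd_edge x y & sd_cap x y <= 0;
  sd_base : sd_pt
}.

Section Retraction.
Context {R : realType} (S : span_data R).
Implicit Types (f g : S -> R) (x y z : S) (c e : R).
Notation edge := (@sd_edge R S).
Notation cap := (@sd_cap R S).

Definition admissible f := forall x y, edge x y -> f x + f y <= cap x y.

Definition tight f :=
  forall x e, 0 < e -> exists2 y, edge x y & cap x y <= f x + f y + e.

(** This is the f' of the overview. The set is nonempty by [sd_cap_le0], and bounded below by [f x]
    when [f] is admissible. *)
Definition polar f x : R := inf [set cap x y - f y | y in edge x].

Lemma polar_ge f x c :
  (forall y, edge x y -> c <= cap x y - f y) -> c <= polar f x.
Proof.
move=> h; apply: lb_le_inf.
  by have [y xy _] := sd_cap_le0 x; exists (cap x y - f y), y.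
by move=> _ [y xy <-]; exact: h.
Qed.

Lemma polar_le f x y : admissible f -> edge x y -> polar f x <= cap x y - f y.
Proof.
move=> adm xy; apply: ge_inf; last by exists y.
by exists (f x) => _ [z xz <-]; have := adm _ _ xz; lra.
Qed.

Lemma le_polar f x : admissible f -> f x <= polar f x.
Proof. by move=> adm; apply: polar_ge => y /adm; lra. Qed.


Lemma polar_lip f g c : admissible g -> (forall x, f x <= g x + c) ->
  forall x, polar g x <= polar f x + c.
Proof.
move=> adm fg x; rewrite -lerBlDr; apply: polar_ge => y xy.
by have := polar_le adm xy; have := fg y; lra.
Qed.

Definition half_step f x : R := (f x + polar f x) / 2.

(** The mean of the bounds [polar f x + f y <= cap x y] and [f x + polar f y <= cap x y]. *)
Lemma half_step_adm f : admissible f -> admissible (half_step f).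
Proof.
move=> adm x y xy; have := polar_le adm xy.
have := polar_le adm (sd_edgeC xy); rewrite /half_step (sd_capC y x); lra.
Qed.

Lemma half_step_ge f x : admissible f -> f x <= half_step f x.
Proof. by move=> /(le_polar x); rewrite /half_step; lra. Qed.

Definition approx n f := iter n half_step f.

Lemma approx_adm n f : admissible f -> admissible (approx n f).
Proof. by move=> adm; elim: n => //= n; exact: half_step_adm. Qed.

Lemma approx_le m n f x : admissible f -> (m <= n)%N ->
  approx m f x <= approx n f x.
Proof.
move=> adm /subnK<-; elim: (n - m)%N => // k ih.
by rewrite addSn (le_trans ih)//=; apply/half_step_ge/approx_adm.
Qed.

Lemma approx_polar n f x : admissible f -> polar (approx n f) x <= polar f x.
Proof.
move=> adm; rewrite -[leRHS]addr0; apply: polar_lip; first exact: approx_adm.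
by move=> y; rewrite addr0 (approx_le y adm (leq0n n)).
Qed.

Lemma approx_le_polar n f x : admissible f -> approx n f x <= polar f x.
Proof.
by move=> adm; rewrite (le_trans _ (approx_polar n x adm))// le_polar//;
  exact: approx_adm.
Qed.

(** A step moves the function to the midpoint of itself and its polar, and the polar can only
    decrease meanwhile. *)
Lemma approx_gap n f x : admissible f ->
  polar (approx n f) x - approx n f x <= (polar f x - f x) / 2 ^+ n.
Proof.
move=> adm; elim: n => [|n ih]; first by rewrite expr0 divr1.
have adn := approx_adm n adm.
have := approx_polar 1 x adn; rewrite /= => h1.
have -> : (polar f x - f x) / 2 ^+ n.+1 = (polar f x - f x) / 2 ^+ n / 2.
  by rewrite exprSr invfM mulrA.
by rewrite /half_step; lra.
Qed.

Lemma approx_lip n f g c : admissible f -> admissible g ->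
  (forall x, `|f x - g x| <= c) -> forall x, `|approx n f x - approx n g x| <= c.
Proof.
move=> af ag fg; elim: n => //= n ih x.
have h1 : forall y, approx n f y <= approx n g y + c.
  by move=> y; have := ih y; rewrite ler_norml => /andP[]; lra.
have h2 : forall y, approx n g y <= approx n f y + c.
  by move=> y; have := ih y; rewrite ler_norml => /andP[]; lra.
have k1 := polar_lip (approx_adm n ag) h1 x.
have k2 := polar_lip (approx_adm n af) h2 x.
move: (h1 x) (h2 x) k1 k2; rewrite /half_step ler_norml => *; apply/andP; lra.
Qed.

(* [approx n f] increases to [retr f], and the defect [polar f - f] is halved at
   every step. *)
Definition retr f x : R := sup (range (fun n => approx n f x)).

Lemma retr_le f x c : (forall n, approx n f x <= c) -> retr f x <= c.
Proof.
move=> h; apply: ge_sup; first by exists (approx 0 f x), 0%N.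
by move=> _ [n _ <-].
Qed.

Lemma approx_le_retr n f x : admissible f -> approx n f x <= retr f x.
Proof.
move=> adm; apply: ub_le_sup; last by exists n.
by exists (polar f x) => _ [k _ <-]; exact: approx_le_polar.
Qed.

Lemma retr_ge f x : admissible f -> f x <= retr f x.
Proof. exact: (@approx_le_retr 0). Qed.

Lemma retr_adm f : admissible f -> admissible (retr f).
Proof.
move=> adm x y xy; rewrite -lerBrDr; apply: retr_le => m.
rewrite lerBrDr addrC -lerBrDr; apply: retr_le => n.
have := approx_adm (maxn m n) adm xy.
have := approx_le x adm (leq_maxl m n); have := approx_le y adm (leq_maxr m n).
lra.
Qed.

Lemma retr_tight f : admissible f -> tight (retr f).
Proof.
move=> adm x e e0.
have d0 : 0 <= polar f x - f x by rewrite subr_ge0 le_polar.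
have [n hn] : exists n, (polar f x - f x) / 2 ^+ n <= e / 2.
  have e20 : 0 < e / 2 by lra.
  (* Since [n < 2 ^ n], an [n] above the quotient of the defect by [e / 2] suffices. *)
  exists (Num.truncn ((polar f x - f x) / (e / 2))).+1.
  rewrite ler_pdivrMr ?exprn_gt0// -ler_pdivrMl// mulrC.
  apply: (le_trans (ltW (truncnS_gt _))).
  by rewrite -natrX ler_nat ltnW// ltn_expl.
have lbx : has_lbound [set cap x y - approx n f y | y in edge x].
  exists (approx n f x) => _ [y xy <-].
  by have := approx_adm n adm xy; lra.
have [_ [y xy <-] hy] : exists2 r, [set cap x y - approx n f y | y in edge x] r &
    r < polar (approx n f) x + e / 2.
  apply: inf_adherent; first by lra.
  split=> //; have [y xy _] := sd_cap_le0 x; by exists (cap x y - approx n f y), y.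
exists y => //; have := approx_gap n x adm.
have := approx_le_retr n x adm; have := approx_le_retr n y adm; lra.
Qed.

Lemma retr_lip f g c : admissible f -> admissible g ->
  (forall x, `|f x - g x| <= c) -> forall x, `|retr f x - retr g x| <= c.
Proof.
move=> af ag fg x; rewrite ler_norml; apply/andP; split.
  rewrite lerBrDr addrC lerBlDr; apply: retr_le => n.
  have := approx_lip n af ag fg x; rewrite ler_norml => /andP[].
  have := approx_le_retr n x af; lra.
rewrite lerBlDr; apply: retr_le => n.
have := approx_lip n af ag fg x; rewrite ler_norml => /andP[].
have := approx_le_retr n x ag; lra.
Qed.

Lemma retr_le_cap f x y : admissible f -> edge x y -> retr f x <= cap x y - f y.
Proof. by move=> af /(retr_adm af); have := retr_ge y af; lra. Qed.

Lemma retr_id f : admissible f -> tight f -> retr f = f.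
Proof.
move=> af tf; apply/funext => x; apply/eqP; rewrite eq_le retr_ge// andbT.
apply/ler_addgt0Pl => e e0; have [y xy h] := tf x e e0.
by have := retr_le_cap af xy; lra.
Qed.

(** The bound [M] of [f] survives: retracting only raises values, and a neighbor [y] with
    [cap x y <= 0] caps the value at [x] by [- f y <= M]. *)
Lemma retr_bounded f : admissible f -> bounded f -> bounded (retr f).
Proof.
move=> af [M fM]; exists M => x; rewrite ler_norml.
have [y xy] := sd_cap_le0 x; have := retr_le_cap af xy; have := retr_ge x af.
have := fM x; have := fM y; rewrite !ler_norml => /andP[? ?] /andP[? ?] ? ? ?.
by apply/andP; lra.
Qed.

End Retraction.

Record tspan (R : realType) (S : span_data R) := TSpan {
  tval :> S -> R;
  tval_bounded : bounded tval;
  tval_adm : admissible tval;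
  tval_tight : tight tval
}.

Section TspanMetric.
Context {R : realType} (S : span_data R).
Implicit Types (f g h : tspan S) (x y z : S) (c e : R).
Notation edge := (@sd_edge R S).
Notation cap := (@sd_cap R S).

Lemma tspan_eq f g : tval f =1 tval g -> f = g.
Proof.
case: f => f f1 f2 f3; case: g => g g1 g2 g3 /= /funext fg; subst g.
by congr TSpan; exact: Prop_irrelevance.
Qed.

HB.instance Definition _ := gen_eqMixin (tspan S).
HB.instance Definition _ := gen_choiceMixin (tspan S).

Definition tdist f g : R := supd f g.

Lemma tdistxx f : tdist f f = 0.
Proof. exact: (supdxx (sd_base S) (tval_bounded f)). Qed.

Lemma tdist_eq0 f g : tdist f g = 0 -> f = g.
Proof. by move=> fg; apply/tspan_eq/supd_eq0 => //; exact: tval_bounded. Qed.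

Lemma tdistC f g : tdist f g = tdist g f. Proof. exact: supdC. Qed.

Lemma tdist_triangle g f h : tdist f h <= tdist f g + tdist g h.
Proof. by apply: (supd_triangle (sd_base S)); exact: tval_bounded. Qed.

HB.instance Definition _ :=
  isMetric.Build R (tspan S) tdistxx tdist_eq0 tdistC tdist_triangle.

Lemma tmdist_ge f g x : `|f x - g x| <= mdist f g.
Proof. by apply: supd_ge; exact: tval_bounded. Qed.

Lemma tmdist_geB f g x : f x - g x <= mdist f g.
Proof. by rewrite (le_trans (ler_norm _))// tmdist_ge. Qed.

Lemma tmdist_le f g c : (forall x, `|f x - g x| <= c) -> mdist f g <= c.
Proof. exact: (supd_le (sd_base S)). Qed.

(** Tightness of [f] at [x] gives an almost tight pair [(x, y)]; admissibility of [g] on it turns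
    the bound at [y] into the opposite bound at [x]. Distances in the span are thus one-sided
    suprema. *)
Lemma tspan_oneside f g c : (forall x, f x - g x <= c) ->
  forall x, g x - f x <= c.
Proof.
move=> fg x; apply/ler_addgt0Pl => e e0.
have [y xy h] := tval_tight f x e0.
by have := tval_adm g xy; have := fg y; lra.
Qed.

Lemma tmdist_leB f g c : (forall x, f x - g x <= c) -> mdist f g <= c.
Proof.
move=> fg; apply: tmdist_le => x; rewrite ler_norml; apply/andP.
by have := fg x; have := tspan_oneside fg x; lra.
Qed.

Lemma tmdist_lipschitz f g x : f x <= g x + mdist f g.
Proof. by rewrite -lerBlDl tmdist_geB. Qed.

Lemma tmdist_sup f g e : 0 < e -> exists x, mdist f g - e < f x - g x.
Proof.
move=> e0; apply: contrapT => /forallNP h.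
suff : mdist f g <= mdist f g - e by lra.
by apply: tmdist_leB => x; rewrite leNgt; apply/negP.
Qed.

Definition retract (f : S -> R) (bf : bounded f) (af : admissible f) : tspan S :=
  TSpan (retr_bounded af bf) (retr_adm af) (retr_tight af).

Lemma retract_lip (f g : S -> R) bf af bg ag c : (forall x, `|f x - g x| <= c) ->
  mdist (@retract f bf af) (@retract g bg ag) <= c.
Proof. by move=> fg; apply: tmdist_le; exact: retr_lip. Qed.

Lemma retract_id f bf af : @retract (tval f) bf af = f.
Proof. by apply: tspan_eq => x /=; rewrite retr_id//; exact: tval_tight. Qed.

Let mix f g t x : R := f x + t * (g x - f x).

Let mix_bounded f g t : bounded (mix f g t).
Proof.
have [M fM] := tval_bounded f; have [N gN] := tval_bounded g.
exists (M + `|t| * (N + M)) => x; rewrite /mix.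
rewrite (le_trans (ler_normD _ _))// lerD// normrM ler_wpM2l//.
by rewrite (le_trans (ler_normB _ _))// lerD.
Qed.

Let mix_adm f g (t : R) : 0 <= t <= 1 -> admissible (mix f g t).
Proof.
move=> /andP[t0 t1] x y xy; have := tval_adm f xy; have := tval_adm g xy.
rewrite /mix; set a := cap x y => h1 h2.
have : t * (g x + g y) <= t * a by rewrite ler_wpM2l.
have : (1 - t) * (f x + f y) <= (1 - t) * a by rewrite ler_wpM2l// subr_ge0.
lra.
Qed.

(** The affine segment from [f] to [g] is admissible, though not tight. Its retraction is a
    1-Lipschitz path that joins [f] to [g] in time [d], hence a geodesic by the triangle
    inequality. *)
Lemma tspan_geodesic : geodesic_space (tspan S).
Proof.
move=> f g; set d := mdist f g.
have [d0|dn0] := eqVneq d 0.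
  have -> : g = f by apply/esym/mdist_positivity.
  exists (fun=> f); rewrite d0; split => // s t.
  by rewrite !inE/= !in_itv/= => st1 st2; rewrite mdistxx (_ : s = t)
    ?subrr ?normr0//; lra.
have d_gt0 : 0 < d by rewrite lt_neqAle eq_sym dn0 mdist_ge0.
have h01 t : Num.min 1 (Num.max 0 (t / d)) \in `[0, 1].
  by rewrite in_itv/= le_min ge_min le_max !lexx ler01.
(* The parameter is clamped to the unit interval because [retract] asks for an admissible function
   at every real [t]. *)
have h01' t : 0 <= Num.min 1 (Num.max 0 (t / d)) <= 1 by have := h01 t; rewrite in_itv.
pose c t := retract (mix_bounded f g _) (@mix_adm f g _ (h01' t)).
have cl (t : R) : 0 <= t <= d -> Num.min 1 (Num.max 0 (t / d)) = t / d.
  move=> /andP[t0 td]; rewrite max_r ?divr_ge0 ?(ltW d_gt0)// min_r//.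
  by rewrite ler_pdivrMr// mul1r.
have c_lip (s t : R) : 0 <= s <= d -> 0 <= t <= d -> mdist (c s) (c t) <= `|s - t|.
  move=> sd td; apply: retract_lip => x; rewrite /mix !cl//.
  have -> : f x + s / d * (g x - f x) - (f x + t / d * (g x - f x)) =
            (s - t) * ((g x - f x) / d) by ring.
  rewrite normrM ler_piMr// normrM normfV (gtr0_norm d_gt0) ler_pdivrMr// mul1r.
  by rewrite distrC tmdist_ge.
have c0 : c 0 = f.
  apply/mdist_positivity/eqP; rewrite eq_le mdist_ge0 andbT.
  rewrite -[X in mdist _ X](retract_id (tval_bounded f) (tval_adm f)).
  apply: retract_lip => x.
  by rewrite /mix cl ?lexx ?(ltW d_gt0)// mul0r mul0r addr0 subrr normr0.
have cd : c d = g.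
  apply/mdist_positivity/eqP; rewrite eq_le mdist_ge0 andbT.
  rewrite -[X in mdist _ X](retract_id (tval_bounded g) (tval_adm g)).
  apply: retract_lip => x.
  rewrite /mix cl ?lexx ?(ltW d_gt0)// divff// mul1r.
  by rewrite subrKC subrr normr0.
exists c; split=> // s t; rewrite !inE/= !in_itv/= => sd td.
apply/eqP; rewrite eq_le c_lip//=.
wlog st : s t sd td / s <= t.
  have [st|/ltW ts] := leP s t; first exact.
  by rewrite distrC metric_sym; exact.
have /andP[s0 _] := sd; have /andP[_ t1] := td.
have dd : 0 <= d <= d by rewrite lexx ltW.
have d0 : 0 <= (0 : R) <= d by rewrite lexx ltW.
have := metric_triangle (c 0) (c s) (c d).
have := metric_triangle (c s) (c t) (c d).
have := c_lip _ _ d0 sd; have := c_lip _ _ td dd.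
rewrite c0 cd -/d sub0r normrN (ger0_norm s0) (distrC t) (distrC s) !ger0_norm; lra.
Qed.

(** The input of the Arzela-Ascoli argument below: equicontinuity on a totally bounded index set,
    phrased without a topology on [S]. *)
Definition finitely_determined := forall r e : R, 0 < e ->
  exists n (a : 'I_n -> S), forall x, exists i, forall f,
    (forall y, `|f y| <= r) -> `|f x - f (a i)| <= e.

(** Arzela-Ascoli: the pointwise limit [h] along an ultrafilter is uniform, and boundedness,
    admissibility and tightness pass to uniform limits. *)
Lemma tspan_proper : finitely_determined -> proper_space (tspan S).
Proof.
move=> fd f0 r; rewrite compact_ultra => F UF Fb.
have [M0 hM0] := tval_bounded f0.
pose M : R := M0 + r.
have FM : F [set f : tspan S | forall y, `|f y| <= M].
  apply: filterS Fb => f /= ffr y; rewrite -[f y](subrK (f0 y)) addrC.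
  rewrite (le_trans (ler_normD _ _))// lerD// (le_trans _ ffr)// metric_sym.
  exact: tmdist_ge.
have hcv x : exists l : R, (fun f : tspan S => f x) @ F --> l.
  have FMx : F [set f : tspan S | f x \in `[- M, M]].
    by apply: filterS FM => f /= /(_ x); rewrite in_itv/= ler_norml.
  have [l _ hl] := ultra_cvg_compact UF (@segment_compact R (- M) M) FMx.
  by exists l.
pose h x := projT1 (cid (hcv x)).
have hE x e : 0 < e -> F [set f : tspan S | `|h x - f x| <= e].
  move=> e0; have := projT2 (cid (hcv x)); rewrite -/(h x).
  by move/cvgrPdist_le => /(_ _ e0).
have unif e : 0 < e -> F [set f : tspan S | forall x, `|h x - f x| <= e].
  move=> e0; have e3 : 0 < e / 5 by lra.
  have [n [a ha]] := fd M _ e3.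
  have FA : F [set f : tspan S | forall i, `|h (a i) - f (a i)| <= e / 5].
    have := @filter_forall _ _ (fun i => [set f : tspan S | `|h (a i) - f (a i)| <= e / 5]) F _.
    by apply => i; exact: hE.
  near=> f; have hfa : forall j, `|h (a j) - f (a j)| <= e / 5 by near: f.
  move=> x; have [i hi] := ha x.
  have hf : `|f x - f (a i)| <= e / 5 by apply: hi; near: f.
  have {}hfa := hfa i.
  (* The set of functions close to [h] at [x] depends on [x] and need not contain [f]. An auxiliary
     [g] in it leads from [h x] to [h (a i)], so that five comparisons link [h x] to [f x]. *)
  have [g [gx ga gM]] : exists g : tspan S, [/\ `|h x - g x| <= e / 5,
      `|h (a i) - g (a i)| <= e / 5 & forall y, `|g y| <= M].
    have [g [[]]] := filter_ex (filterI (filterI (hE x _ e3) FA) FM).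
    by move=> /= ? ? ?; exists g.
  have := hi _ gM; move: hf hfa gx ga; rewrite !ler_norml.
  move=> /andP[? ?] /andP[? ?] /andP[? ?] /andP[? ?] /andP[? ?]; apply/andP; lra.
have hb : bounded h.
  exists (M + 1) => x; have [f [/= /(_ x) fh /(_ x) fM]] :=
    filter_ex (filterI (unif _ ltr01) FM).
  move: fh fM; rewrite !ler_norml => /andP[? ?] /andP[? ?]; apply/andP; lra.
have ha : admissible h.
  move=> x y xy; apply/ler_addgt0Pl => e e0; have e3 : 0 < e / 2 by lra.
  have [f /= fh] := filter_ex (unif _ e3).
  have := fh x; have := fh y; rewrite !ler_norml => /andP[? ?] /andP[? ?].
  by have := tval_adm f xy; lra.
have ht : tight h.
  move=> x e e0; have e3 : 0 < e / 3 by lra.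
  have [f /= fh] := filter_ex (unif _ e3).
  have [y xy hy] := tval_tight f x e3; exists y => //.
  by have := fh x; have := fh y; rewrite !ler_norml => /andP[? ?] /andP[? ?]; lra.
pose H := TSpan hb ha ht.
have FH : F --> H.
  apply/(@metricType_numDomainType.fcvgrPdist_lt _ _ F) => e e0.
  have e2 : 0 < e / 2 by lra.
  by near=> f; apply: (@le_lt_trans _ _ (e / 2)); [apply: tmdist_le; near: f; exact: unif | lra].
exists H; split => //=; rewrite /cball/=; apply/ler_addgt0Pl => e e0.
have : F [set f | mdist H f < e].
  by have /(@metricType_numDomainType.fcvgrPdist_lt _ _ F) := FH; exact.
move=> /(filterI Fb)/filter_ex[f [/= f1 f2]]; rewrite /cball/= in f1.
by have := metric_triangle f0 f H; rewrite (metric_sym f H); lra.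
Unshelve. all: by end_near. Qed.

End TspanMetric.

(** * Estimates for the logarithm and the exponential *)

Section LnExp.
Context {R : realType}.
Implicit Types a b x y : R.

Lemma ler_lnB a b : 0 < a -> 0 < b -> ln a - ln b <= a / b - 1.
Proof.
move=> a0 b0; rewrite -ln_div ?posrE//.
have := @le_ln1Dx R (a / b - 1); rewrite subrKC; apply.
by have := divr_gt0 a0 b0; lra.
Qed.

Lemma ler_dist_expR x y : x <= 0 -> y <= 0 -> `|expR x - expR y| <= `|x - y|.
Proof.
wlog yx : x y / y <= x.
  have [yx|/ltW xy] := leP y x; first exact.
  by move=> h x0 y0; rewrite distrC (distrC x); exact: h.
move=> x0 y0; rewrite !ger0_norm ?subr_ge0 ?ler_expR//.
have -> : expR x - expR y = expR x * (1 - expR (y - x)).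
  by rewrite mulrBr mulr1 -expRD subrKC.
have := expR_ge1Dx (y - x); have : expR x <= 1 by rewrite expR_le1.
have := expR_gt0 x; have : expR (y - x) <= 1 by rewrite expR_le1; lra.
nra.
Qed.

End LnExp.

(** * The space of antipodal functions *)

(* Compactness is expressed by the convergence of ultrafilters, and the
   continuity of [rho] by its uniform continuity. *)
Record antipodal (R : realType) := Antipodal {
  ap_pt :> Type;
  rho : ap_pt -> ap_pt -> R;
  rho_ge0 : forall x y, 0 <= rho x y;
  rho_le1 : forall x y, rho x y <= 1;
  rhoC : forall x y, rho x y = rho y x;
  rhoxx : forall x, rho x x = 0;
  rho_eq0 : forall x y, rho x y = 0 -> x = y;
  rho_antipode : forall x, exists y, rho x y = 1;
  rho_unif : forall e, 0 < e -> exists2 d, 0 < d &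
    forall x x', rho x x' <= d -> forall y, `|rho x y - rho x' y| <= e;
  rho_ultra : forall F : set_system ap_pt, UltraFilter F ->
    exists x, forall e, 0 < e -> F [set y | rho x y <= e];
  ap_four : (`I_4 #<= [set: ap_pt])%card
}.

Section Antipodal.
Context {R : realType} (Z : antipodal R).
Implicit Types (x y z : Z) (c e r t : R).
Notation rho := (@rho R Z).

Lemma rho_gt0 x y : x <> y -> 0 < rho x y.
Proof.
by move=> xy; rewrite lt0r rho_ge0 andbT; apply/eqP => /rho_eq0.
Qed.

Lemma rho_neq x y : 0 < rho x y -> x <> y.
Proof. by move=> + xy; rewrite xy rhoxx ltxx. Qed.

Lemma ap_pointed : exists x : Z, True.
Proof.
apply: contrapT => Z0; have Z_set0 : [set: Z] = set0.
  by rewrite -subset0 => x _; apply: Z0; exists x.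
have := @ap_four R Z; rewrite Z_set0 card_le0 => /eqP I40.
by have : `I_4 0%N by []; rewrite I40.
Qed.

Definition ap_base : Z := projT1 (cid ap_pointed).

Let edge x y : Prop := x <> y.
Let cap x y : R := - 2 * ln (rho x y).
Let edgeC x y : edge x y -> edge y x.
Proof. by move=> xy /esym. Qed.
Let capC x y : cap x y = cap y x.
Proof. by rewrite /cap rhoC. Qed.
Let cap_le0 x : exists2 y, edge x y & cap x y <= 0.
Proof.
have [y xy] := rho_antipode x; exists y; last by rewrite /cap xy ln1 mulr0.
by apply: rho_neq; rewrite xy.
Qed.

Canonical ap_span : span_data R := SpanData edgeC capC cap_le0 ap_base.

Notation T := (tspan ap_span).
Implicit Types f g h : T.

Lemma ap_adm f x y : x <> y -> f x + f y <= - 2 * ln (rho x y).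
Proof. exact: (@tval_adm _ _ f). Qed.

(** The left side is the antipodal function with density [f]. In this form the constraint also holds
    on the diagonal. *)
Lemma ap_adm_exp f x y : rho x y * expR ((f x + f y) / 2) <= 1.
Proof.
have [->|/rho_gt0 xy0] := pselect (x = y); first by rewrite rhoxx mul0r.
rewrite -{1}(lnK xy0) -expRD expR_le1.
by have := ap_adm f (rho_neq xy0); lra.
Qed.

Lemma cap_expE x y c : x <> y ->
  (rho x y * expR (c / 2) = 1) <-> (c = - 2 * ln (rho x y)).
Proof.
move=> /rho_gt0 xy0; rewrite -{1}(lnK xy0) -expRD; split.
  by move=> /(congr1 (@ln R)); rewrite expRK ln1; lra.
by move=> ->; rewrite -[RHS]expR0; congr expR; lra.
Qed.

Let tzero_tight : tight (fun _ : ap_span => 0 : R).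
Proof.
move=> x e e0; have [y xy] := rho_antipode x; exists y.
  by apply: rho_neq; rewrite xy.
by rewrite /= /cap xy ln1; lra.
Qed.

Let tzero_adm : admissible (fun _ : ap_span => 0 : R).
Proof.
by move=> x y _ /=; rewrite /cap; have := ln_le0 (rho_le1 x y); lra.
Qed.

Let tzero_bounded : bounded (fun _ : ap_span => 0 : R).
Proof. by exists 0 => x; rewrite normr0. Qed.

Definition tzero : T := TSpan tzero_bounded tzero_adm tzero_tight.

Definition nrm f := mdist tzero f.

Lemma nrm_ge f x : `|f x| <= nrm f.
Proof. by rewrite -[f x]subr0 /nrm metric_sym; exact: (tmdist_ge f tzero). Qed.

Lemma nrm_bound f x : - nrm f <= f x <= nrm f.
Proof. by rewrite -ler_norml nrm_ge. Qed.

Lemma nrm_le f c : (forall x, `|f x| <= c) -> nrm f <= c.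
Proof.
by move=> h; rewrite /nrm metric_sym; apply: tmdist_le => x; rewrite /= subr0.
Qed.

Lemma nrm_ge0 f : 0 <= nrm f. Proof. exact: mdist_ge0. Qed.

(** An almost tight partner [z] of [x] satisfies [rho x z >= expR (- r - 1)], because [f] is bounded
    by [r]. So [ln (rho y z)] is close to [ln (rho x z)] for [y] near [x], and admissibility on
    [(y, z)] bounds [f y] by [f x + e]. *)
Lemma tspan_equicontinuous r e : 0 < e -> exists2 d, 0 < d &
  forall x y, rho x y <= d -> forall f, (forall z, `|f z| <= r) ->
  `|f x - f y| <= e.
Proof.
move=> e0; pose s := Num.min 1 (e / 2).
have s0 : 0 < s by rewrite lt_min ltr01/=; lra.
have s1 : s <= 1 by rewrite ge_min lexx.
have se : s <= e / 2 by rewrite ge_min lexx orbT.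
pose k := expR (- r - 1); have k0 : 0 < k := expR_gt0 _.
pose n := Num.min (k / 2) (k * e / 8).
have n0 : 0 < n by rewrite lt_min !divr_gt0// mulr_gt0.
have n1 : n <= k / 2 by rewrite ge_min lexx.
have n2 : n <= k * e / 8 by rewrite ge_min lexx orbT.
have [d d0 hd] := rho_unif Z n0.
exists d => //.
suff H x y : rho x y <= d -> forall f, (forall z, `|f z| <= r) -> f y - f x <= e.
  move=> x y xy f fr; rewrite ler_norml; have := H x y xy f fr.
  by rewrite rhoC in xy; have := H y x xy f fr; move=> ? ?; apply/andP; lra.
move=> xy f fr; have [z xz hz] := tval_tight f x s0.
have xz0 := rho_gt0 xz; rewrite /= /cap in hz.
have fz := fr z; have fx := fr x; rewrite !ler_norml in fz fx.
move: fz fx => /andP[fz1 fz2] /andP[fx1 fx2].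
have rk : k <= rho x z.
  by rewrite -(lnK xz0) /k ler_expR; lra.
have /hd-/(_ z) := xy; rewrite ler_norml => /andP[d1 d2].
have yz0 : 0 < rho y z by lra.
have := ap_adm f (rho_neq yz0); have := ler_lnB xz0 yz0 => l1 l2.
suff : rho x z / rho y z - 1 <= e / 4 by lra.
rewrite lerBlDr ler_pdivrMr//.
have : k / 2 <= rho y z by lra.
nra.
Qed.

Lemma ap_net d : 0 < d -> exists n (a : 'I_n -> Z), forall x, exists i, rho (a i) x <= d.
Proof.
move=> d0; have [F UF _|m [b [_ hb]]] :=
    @ultra_finite_cover Z setT (fun x y => rho x y <= d) ap_base.
  by have [x hx] := rho_ultra UF; exists x; exact: hx.
by exists m.+1, b => x; exact: hb.
Qed.

Lemma ap_determined : finitely_determined ap_span.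
Proof.
move=> r e e0; have [d d0 hd] := tspan_equicontinuous r e0.
have [n [a ha]] := ap_net d0; exists n, a => x; have [i hi] := ha x.
by exists i => f fr; apply: hd => //; rewrite rhoC.
Qed.

Lemma ap_proper : proper_space T.
Proof. exact/tspan_proper/ap_determined. Qed.

(** An upper semicontinuous function attains its supremum: take the limit of an ultrafilter
    containing all superlevel sets. *)
Lemma ap_attain (phi : Z -> R) M :
  (forall x, phi x <= M) -> (forall e, 0 < e -> exists x, M - e < phi x) ->
  (forall x e, 0 < e -> exists2 d, 0 < d & forall y, rho x y <= d ->
    phi y <= phi x + e) ->
  exists x, phi x = M.
Proof.
move=> ub ap usc.
pose B (e : R) := [set x | M - e < phi x].
have PF : ProperFilter (filter_from (fun e : R => 0 < e) B).
  apply: filter_from_proper => //.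
  apply: filter_from_filter; first by exists 1; rewrite /= ltr01.
  move=> s t s0 t0; exists (Num.min s t); first by rewrite lt_min s0.
  move=> x; rewrite /B/= => h.
  have : Num.min s t <= s by rewrite ge_min lexx.
  have : Num.min s t <= t by rewrite ge_min lexx orbT.
  by split; lra.
have [G [UG FG]] := ultraFilterLemma PF.
have [x hx] := rho_ultra UG; exists x.
apply/eqP; rewrite eq_le ub; apply/ler_addgt0Pl => e e0.
have e2 : 0 < e / 2 by lra.
have [d d0 hd] := usc x _ e2.
have G1 : G (B (e / 2)) by apply: FG; exists (e / 2).
have [y /= [/hd h1 h2]] := filter_ex (filterI (hx _ d0) G1).
by rewrite /B/= in h2; lra.
Qed.

Lemma tval_usc f x e : 0 < e ->
  exists2 d, 0 < d & forall y, rho x y <= d -> `|f x - f y| <= e.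
Proof.
move=> e0; have [d d0 hd] := tspan_equicontinuous (nrm f) e0.
by exists d => // y xy; apply: hd => // z; exact: nrm_ge.
Qed.

Lemma tmdist_attain f g : exists x, f x - g x = mdist f g.
Proof.
apply: (@ap_attain (fun x => f x - g x)) => [x|e|x e e0].
- exact: tmdist_geB.
- by move=> e0; have [x hx] := tmdist_sup f g e0; exists x.

have e2 : 0 < e / 2 by lra.
have [d d0 hd] := tval_usc f x e2; have [d' d0' hd'] := tval_usc g x e2.
exists (Num.min d d'); first by rewrite lt_min d0.
move=> y; rewrite le_min => /andP[/hd + /hd'].
by rewrite !ler_norml => /andP[? ?] /andP[? ?]; lra.
Qed.

Lemma nrm_attain f : exists x, f x = nrm f.
Proof.
by have [x hx] := tmdist_attain f tzero; exists x; rewrite /nrm metric_sym -hx subr0.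
Qed.

Lemma nrm_attainN f : exists x, f x = - nrm f.
Proof.
by have [x hx] := tmdist_attain tzero f; exists x; rewrite /nrm -hx sub0r opprK.
Qed.

(** Compactness upgrades tightness to an equality. The exponential form is maximized, because it
    stays continuous at [y = x], where the logarithm is singular. *)
Lemma ap_partner f x : exists2 y, x <> y & f x + f y = - 2 * ln (rho x y).
Proof.
suff [y hy] : exists y, rho x y * expR ((f x + f y) / 2) = 1.
  have xy : x <> y by move=> xy; move: hy; rewrite xy rhoxx mul0r => /eqP; rewrite eq_sym oner_eq0.
  by exists y => //; apply/(cap_expE _ xy).
apply: (@ap_attain (fun y => rho x y * expR ((f x + f y) / 2))).
- by move=> y; exact: ap_adm_exp.
- move=> e e0; have e2 : 0 < e / 2 by lra.
  have [y xy hy] := tval_tight f x e0; exists y.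
  have xy0 := rho_gt0 xy; rewrite -{1}(lnK xy0) -expRD; rewrite /= /cap in hy.
  apply: (lt_le_trans _ (expR_ge1Dx _)); lra.
- move=> y e e0; set K := expR (nrm f).
  have K0 : 0 < K := expR_gt0 _.
  have nf := nrm_ge0 f.
  have K1 : 1 <= K by rewrite -[1]expR0 ler_expR.
  (* [K] bounds the exponential factor [b], and the error [(rho x y + 1 + d) * (d * b)] found below
     is at most [3 * d * K]. *)
  pose d := Num.min 1 (e / (4 * K)).
  have d0 : 0 < d by rewrite lt_min ltr01/= divr_gt0// mulr_gt0//; lra.
  have [d1 d10 hd1] := rho_unif Z d0.
  have [d2 d20 hd2] := tval_usc f y d0.
  exists (Num.min d1 d2); first by rewrite lt_min d10.
  move=> z; rewrite le_min => /andP[/hd1 /(_ x) + /hd2].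
  rewrite (rhoC y) (rhoC z) !ler_norml => /andP[h1 h2] /andP[h3 h4].
  have dK : d * K * 4 <= e.
    rewrite -mulrA (mulrC K) -ler_pdivlMr; last by rewrite mulr_gt0//; lra.
    by rewrite ge_min lexx orbT.
  set b := expR ((f x + f y) / 2); set a := expR _.
  have bK : b <= K.
    by rewrite ler_expR; have := nrm_bound f x; have := nrm_bound f y; lra.
  have b0 : 0 < b := expR_gt0 _.
  have a0 : 0 < a := expR_gt0 _.
  have ab : a <= b * (1 + d).
    have -> : a = b * expR ((f z - f y) / 2) by rewrite -expRD; congr expR; lra.
    rewrite ler_wpM2l ?(ltW b0)//.
    have dd : d <= 1 by rewrite ge_min lexx.
    have q : 0 < 1 - d / 2 by lra.
    rewrite -[X in X <= _]invrK -expRN invf_ple ?posrE ?expR_gt0//; last lra.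
    apply: le_trans (expR_ge1Dx _).
    rewrite -[X in X <= _]mul1r ler_pdivrMr; last lra.
    by nra.
  have := rho_ge0 x y; have := rho_le1 x y.
  have dd : d <= 1 by rewrite ge_min lexx.
  move=> r1 r0.
  have : rho x z * a <= (rho x y + d) * (b * (1 + d)).
    by apply: ler_pM => //; [exact: rho_ge0|exact: ltW|lra].
  have : d * b <= d * K by rewrite ler_wpM2l// ltW.
  move=> k1 k2; apply: (le_trans k2).
  have -> : (rho x y + d) * (b * (1 + d)) = rho x y * b + (rho x y + 1 + d) * (d * b) by ring.
  rewrite lerD2l; apply: (@le_trans _ _ (3 * (d * b))); last lra.
  apply: ler_wpM2r; [by rewrite mulr_ge0 ?ltW|lra].
Qed.

Section Rays.
Variables (f : T) (x : Z).

(** Lowering the other values by [t] compensates the jump at [x] in every constraint. Truncating [t]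
    at 0 keeps the function admissible for all real [t]. *)
Let bend t : ap_span -> R :=
  fun z => if `[< z = x >] then f x + Num.max 0 t else f z - Num.max 0 t.

Let bend_bounded t : bounded (bend t).
Proof.
exists (nrm f + Num.max 0 t) => z; rewrite /bend.
have t0 : 0 <= Num.max 0 t by rewrite le_max lexx.
case: ifP => _; rewrite ler_norml; apply/andP;
  [have := nrm_bound f x|have := nrm_bound f z]; lra.
Qed.

Let bend_adm t : admissible (bend t).
Proof.
move=> y z yz; rewrite /bend /= /cap.
have t0 : 0 <= Num.max 0 t by rewrite le_max lexx.
have := ap_adm f yz.
case: asboolP => [yx|_]; case: asboolP => [zx|_]; rewrite ?zx ?yx; try lra.
by case: yz; rewrite yx zx.
Qed.

(* The geodesic ray from [f] to the boundary point [x]; retracting after the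
   jump by [t] at [x] works because [cap x x] imposes no constraint. *)
Definition ray t : T := retract (bend_bounded t) (bend_adm t).

Lemma ray_lip s t : mdist (ray s) (ray t) <= `|s - t|.
Proof.
apply: retract_lip => z; rewrite /bend.
have H : `|Num.max 0 s - Num.max 0 t| <= `|s - t|.
  have Hs : Num.max 0 s = if s <= 0 then 0 else s by case: leP.
  have Ht : Num.max 0 t = if t <= 0 then 0 else t by case: leP.
  rewrite Hs Ht; case: (leP s 0) => s0; case: (leP t 0) => t0; rewrite ?subrr ?normr0//.
    by rewrite !ler0_norm; lra.
  by rewrite !ger0_norm; lra.
case: ifP => _; first by rewrite [_ - _](_ : _ = Num.max 0 s - Num.max 0 t)//; ring.
by rewrite [_ - _](_ : _ = - (Num.max 0 s - Num.max 0 t)) ?normrN//; ring.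
Qed.

Lemma ray0 : ray 0 = f.
Proof.
apply/mdist_positivity/eqP; rewrite eq_le mdist_ge0 andbT.
rewrite -[X in mdist _ X](retract_id (tval_bounded f) (tval_adm f)).
apply: retract_lip => z; rewrite /bend maxxx addr0 subr0.
by case: asboolP => [->|_]; rewrite subrr normr0.
Qed.

Lemma ray_at t : 0 <= t -> ray t x = f x + t.
Proof.
move=> t0; apply/eqP; rewrite eq_le; apply/andP; split.
  have := tmdist_lipschitz (ray t) (ray 0) x; have := ray_lip t 0.
  by rewrite ray0 subr0 ger0_norm//; lra.
by have := retr_ge x (@bend_adm t); rewrite {1}/bend asboolT// (max_r t0).
Qed.

End Rays.

(** Choose [x] at which the increase from [c a] to [c b] is the whole distance, and a partner [y] of
    [x] for [c a]. Continue [c] by the ray from [c b] to [x], and backwards by the ray from [c a] to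
    [y]: as the value at [y] grows, admissibility pushes the value at [x] down. The value at [x]
    then has slope 1 along the whole 1-Lipschitz path, which is therefore a geodesic. *)
Lemma ap_complete : geodesically_complete T.
Proof.
move=> a b c ab cg.
have cE s t : a <= s <= b -> a <= t <= b -> mdist (c s) (c t) = `|s - t|.
  by move=> hs ht; apply: cg; rewrite inE /= in_itv.
have haa : a <= a <= b by rewrite lexx.
have hbb : a <= b <= b by rewrite lexx andbT.
have [x hx] := tmdist_attain (c b) (c a).
have [y xy hy] := ap_partner (c a) x.
have L : mdist (c b) (c a) = b - a by rewrite cE// ger0_norm ?subr_ge0.
pose c' t := if t < a then ray (c a) y (a - t) else
  if t <= b then c t else ray (c b) x (t - b).
have phi t : c' t x = c a x + (t - a).
  rewrite /c'; case: ltP => [ta|at_].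
    have := ap_adm (ray (c a) y (a - t)) xy; rewrite ray_at ?subr_ge0 ?(ltW ta)//.
    have := tmdist_lipschitz (c a) (ray (c a) y (a - t)) x.
    have := ray_lip (c a) y 0 (a - t); rewrite ray0 sub0r normrN gtr0_norm ?subr_gt0//.
    by move=> ? ? ?; apply/eqP; rewrite eq_le; apply/andP; lra.
  case: (leP t b) => tb; last by rewrite ray_at ?subr_ge0 ?(ltW tb)//; lra.
  have ht : a <= t <= b by rewrite at_.
  have := tmdist_lipschitz (c t) (c a) x; have := tmdist_lipschitz (c b) (c t) x.
  rewrite !cE// !ger0_norm ?subr_ge0//.
  by move=> ? ?; apply/eqP; rewrite eq_le; apply/andP; lra.
have lip s t : s <= t -> mdist (c' s) (c' t) <= t - s.
  move=> st; rewrite /c'; case: ltP => [sa|as_]; case: ltP => [ta|at_].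
  - by rewrite (le_trans (ray_lip _ _ _ _))// ger0_norm; lra.
  - have := metric_triangle (ray (c a) y (a - s)) (c a).
    have := ray_lip (c a) y (a - s) 0; rewrite ray0 subr0 gtr0_norm ?subr_gt0// => h1 h2.
    case: (leP t b) => tb.
      have ht : a <= t <= b by rewrite at_.
      by have := h2 (c t); rewrite cE// distrC ger0_norm ?subr_ge0//; lra.
    have := ray_lip (c b) x 0 (t - b); rewrite ray0 sub0r normrN gtr0_norm ?subr_gt0// => h3.
    have := h2 (ray (c b) x (t - b)).
    have := metric_triangle (c a) (c b) (ray (c b) x (t - b)).
    by rewrite (metric_sym (c a) (c b)) L; lra.
  - by lra.
  - case: (leP s b) => sb; case: (leP t b) => tb; try lra.
    + by rewrite cE ?as_ ?at_// distrC ger0_norm ?subr_ge0//.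
    + have := ray_lip (c b) x 0 (t - b); rewrite ray0 sub0r normrN gtr0_norm ?subr_gt0// => h3.
      have := metric_triangle (c s) (c b) (ray (c b) x (t - b)).
      rewrite cE ?as_ ?sb// distrC ger0_norm ?subr_ge0//; lra.
    + by rewrite (le_trans (ray_lip _ _ _ _))// distrC ger0_norm; lra.
exists c'; split; last first.
  move=> t; rewrite in_itv/= => /andP[at_ tb].
  by rewrite /c' ltNge at_/= tb.
move=> s t _ _.
wlog st : s t / s <= t.
  have [st|/ltW ts] := leP s t; first exact.
  by rewrite distrC metric_sym; exact.
apply/eqP; rewrite eq_le distrC (ger0_norm (_ : 0 <= t - s)) ?subr_ge0// lip//=.
have := tmdist_lipschitz (c' t) (c' s) x; rewrite !phi metric_sym; lra.
Qed.

End Antipodal.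

(** * The compactification by the boundary *)

Inductive hat (R : realType) (Z : antipodal R) :=
  | Hin of tspan (ap_span Z)
  | Hbd of Z.

Arguments Hin {R Z}.
Arguments Hbd {R Z}.

Section Hat.
Context {R : realType} (Z : antipodal R).
Implicit Types (x y z : Z) (c e r t : R).
Notation T := (tspan (ap_span Z)).
Notation H := (hat Z).
Implicit Types (f g h : T) (p q : H).

HB.instance Definition _ := gen_eqMixin (hat Z).
HB.instance Definition _ := gen_choiceMixin (hat Z).
HB.instance Definition _ := isPointed.Build (hat Z) (Hin (tzero Z)).

(* [expprod p q] is [exp (- (p|q)_o)] for the base point [o = tzero]. *)
Definition expprod p q : R :=
  match p, q with
  | Hin f, Hin g => expR (- ((nrm f + nrm g - mdist f g) / 2))
  | Hin f, Hbd x | Hbd x, Hin f => expR (- ((nrm f + f x) / 2))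
  | Hbd x, Hbd y => rho x y
  end.

Definition trace p x := expprod p (Hbd x).

Lemma expprodC p q : expprod p q = expprod q p.
Proof.
case: p q => [f|x] [g|y] //=; last exact: rhoC.
by rewrite metric_sym (addrC (nrm f)).
Qed.

(* [weight f] is at most [1] and [expprod (Hin f) p] is the maximum of
   [weight f x * trace p x] over [x]; hence [expprod] is 1-Lipschitz in each
   variable for the sup distance between traces. *)
Definition weight f x : R := expR (- ((nrm f - f x) / 2)).

Lemma weight_gt0 f x : 0 < weight f x. Proof. exact: expR_gt0. Qed.

Lemma weight_le1 f x : weight f x <= 1.
Proof. by rewrite expR_le1; have := nrm_bound f x; lra. Qed.

Lemma weight_le_expprod f p x : weight f x * trace p x <= expprod (Hin f) p.
Proof.
case: p => [g|y]; rewrite /trace /weight /=.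
  by rewrite -expRD ler_expR; have := tmdist_geB f g x; lra.
have := ap_adm_exp f x y; rewrite rhoC => h.
have -> : expR (- ((nrm f + f y) / 2)) =
  expR (- ((nrm f - f x) / 2)) * (1 / expR ((f y + f x) / 2)).
  by rewrite mul1r -expRN -expRD; congr expR; lra.
rewrite ler_wpM2l ?expR_ge0// ler_pdivlMr ?expR_gt0//.
by rewrite (addrC (f y)).
Qed.

Lemma expprod_attain f p : exists x, weight f x * trace p x = expprod (Hin f) p.
Proof.
case: p => [g|y].
  have [x hx] := tmdist_attain f g; exists x.
  by rewrite /weight /trace /= -expRD -hx; congr expR; lra.
have [x xy hx] := ap_partner f y; exists x; rewrite /weight /trace /=.
have := (cap_expE (f y + f x) xy).2 hx; rewrite rhoC => h.
have -> : expR (- ((nrm f + f y) / 2)) =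
  expR (- ((nrm f - f x) / 2)) * (1 / expR ((f y + f x) / 2)).
  by rewrite mul1r -expRN -expRD; congr expR; lra.
congr (_ * _); apply: (canRL (mulfK _)) => //.
by rewrite gt_eqF// expR_gt0.
Qed.

Lemma trace_ge0 p x : 0 <= trace p x.
Proof. by case: p => [f|y] /=; [exact: expR_ge0 | exact: rho_ge0]. Qed.

Lemma trace_le1 p x : trace p x <= 1.
Proof.
case: p => [f|y]; last exact: rho_le1.
by rewrite /trace/= expR_le1; have := nrm_bound f x; lra.
Qed.

Lemma trace_bounded p : bounded (trace p).
Proof. by exists 1 => x; rewrite ger0_norm ?trace_ge0 ?trace_le1. Qed.

Lemma expprod_lip1 e f p q : (forall x, `|trace p x - trace q x| <= e) ->
  expprod (Hin f) p <= expprod (Hin f) q + e.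
Proof.
move=> pq; have [x <-] := expprod_attain f p.
rewrite -lerBlDr; apply: le_trans (weight_le_expprod f q x).
have e0 : 0 <= e by apply: le_trans (pq x).
have := pq x; rewrite ler_norml => /andP[_ h].
rewrite lerBlDr (@le_trans _ _ (weight f x * (trace q x + e)))//.
  by apply: ler_wpM2l; [exact: ltW (weight_gt0 _ _)|lra].
by rewrite mulrDr lerD2l ler_piMl ?weight_le1.
Qed.

Definition hdist p q : R := supd (trace p) (trace q).

Lemma hdist_ge p q x : `|trace p x - trace q x| <= hdist p q.
Proof. by apply: supd_ge; exact: trace_bounded. Qed.

Lemma hdist_le p q c : (forall x, `|trace p x - trace q x| <= c) -> hdist p q <= c.
Proof. exact: (supd_le (ap_base Z)). Qed.

(* [exp (- d(o, p))], which vanishes exactly on the boundary *)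
Definition depth p : R := if p is Hin f then expR (- nrm f) else 0.

(** With [depth_attain], this makes the depth the minimum of the trace, hence a continuous function
    for the distance of traces. *)
Lemma depth_le p x : depth p <= trace p x.
Proof.
case: p => [f|y] /=; last exact: rho_ge0.
by rewrite ler_expR; have := nrm_bound f x; lra.
Qed.

Lemma depth_attain p : exists x, trace p x = depth p.
Proof.
case: p => [f|y]; last by exists y; rewrite /trace/= rhoxx.
by have [x hx] := nrm_attain f; exists x; rewrite /trace/= hx; congr expR; lra.
Qed.

Lemma depth_lip1 p q c : (forall x, `|trace p x - trace q x| <= c) ->
  depth p - depth q <= c.
Proof.
move=> h; have [x hx] := depth_attain q.
by have := depth_le p x; have := h x; rewrite hx ler_norml => /andP[]; lra.
Qed.

Lemma depth_lip p q : `|depth p - depth q| <= hdist p q.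
Proof.
have := depth_lip1 (@hdist_ge p q); have := depth_lip1 (@hdist_ge q p).
by rewrite /hdist supdC ler_norml => *; apply/andP; lra.
Qed.

Lemma hdistxx p : hdist p p = 0.
Proof. exact: (supdxx (ap_base Z) (trace_bounded p)). Qed.

Lemma hdistC p q : hdist p q = hdist q p. Proof. exact: supdC. Qed.

Lemma hdist_triangle q p q' : hdist p q' <= hdist p q + hdist q q'.
Proof. by apply: (supd_triangle (ap_base Z)); exact: trace_bounded. Qed.

(** Equal traces have equal minima; these separate interior from boundary points and give the norm,
    after which the trace determines [f]. *)
Lemma hdist_eq0 p q : hdist p q = 0 -> p = q.
Proof.
move=> pq0; have pq : trace p =1 trace q by apply: supd_eq0 => //; exact: trace_bounded.
have dpq : depth p = depth q.
  by have := depth_lip p q; rewrite pq0 normr_le0 subr_eq0 => /eqP.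
move: p q pq dpq {pq0} => [f|x] [g|y] pq /=.
- move=> /expR_inj fg; congr Hin; apply: tspan_eq => x.
  by have := pq x; rewrite /trace/= => /expR_inj; lra.
- by move/eqP; rewrite gt_eqF// expR_gt0.
- by move/eqP; rewrite lt_eqF// expR_gt0.
- move=> _; congr Hbd; apply/rho_eq0.
  by have := pq y; rewrite /trace/= rhoxx.
Qed.

HB.instance Definition _ :=
  isMetric.Build R (hat Z) hdistxx hdist_eq0 hdistC hdist_triangle.

Lemma hmdist_ge p q x : `|trace p x - trace q x| <= mdist p q.
Proof. exact: hdist_ge. Qed.

Lemma hmdist_le p q c : (forall x, `|trace p x - trace q x| <= c) -> mdist p q <= c.
Proof. exact: hdist_le. Qed.

Lemma expprod_lip p q q' : `|expprod p q - expprod p q'| <= mdist q q'.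
Proof.
case: p => [f|x]; last by rewrite (expprodC _ q) (expprodC _ q'); exact: hmdist_ge.
have h1 := expprod_lip1 f (@hmdist_ge q q').
have h2 := expprod_lip1 f (@hmdist_ge q' q).
by rewrite ler_norml; apply/andP; rewrite (metric_sym q') in h2; lra.
Qed.

Lemma Hin_lip f g : mdist (Hin f) (Hin g) <= mdist f g.
Proof.
apply: hmdist_le => x; rewrite /trace/=.
apply: (le_trans (ler_dist_expR _ _)).
- by have := nrm_bound f x; lra.
- by have := nrm_bound g x; lra.
have := tmdist_ge f g x; rewrite /nrm.
have := metric_triangle (tzero Z) f g; have := metric_triangle (tzero Z) g f.
by rewrite (metric_sym g f) !ler_norml => ? ? /andP[? ?]; apply/andP; lra.
Qed.

Lemma Hin_continuous : continuous (@Hin R Z).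
Proof.
apply: continuous_mdist => f e e0; exists e => // g.
exact/le_lt_trans/Hin_lip.
Qed.

(** Near [Hin f] all traces and depths exceed [c / 2], where the logarithm is Lipschitz with
    constant [2 / c]. So half sums of norm and value differ by at most [e / 6], as do the norms, and
    values by at most [e / 2]. *)
Lemma Hin_inv f e : 0 < e -> exists2 d, 0 < d &
  forall p, mdist (Hin f) p < d -> exists2 g, p = Hin g & mdist f g < e.
Proof.
move=> e0; set c := expR (- nrm f); have c0 : 0 < c := expR_gt0 _.
pose d := Num.min (c / 2) (c * e / 12).
have d0 : 0 < d by rewrite lt_min !divr_gt0// mulr_gt0.
have d1 : d <= c / 2 by rewrite ge_min lexx.
have d2 : d <= c * e / 12 by rewrite ge_min lexx orbT.
exists d => // p fp.
have := le_lt_trans (depth_lip (Hin f) p) fp; rewrite ltr_norml /= -/c => /andP[h1 h2].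
have hp : c / 2 <= depth p by lra.
case: p fp h1 h2 hp => [g|x]; last by rewrite /=; lra.
move=> fg /= h1 h2 hg; exists g => //.
have key a b : c / 2 <= expR a -> c / 2 <= expR b -> - d < expR a - expR b < d ->
    `|a - b| <= e / 6.
  suff K a' b' : c / 2 <= expR b' -> expR a' - expR b' < d -> a' - b' <= e / 6.
    move=> ha hb /andP[ab1 ab2].
    by rewrite ler_norml; apply/andP; have := K a b hb ab2;
      have := K b a ha; lra.
  move=> hb ab; have := ler_lnB (expR_gt0 a') (expR_gt0 b'); rewrite !expRK => h.
  apply: (le_trans h); rewrite lerBlDr ler_pdivrMr ?expR_gt0//; nra.
have n1 : `|nrm f - nrm g| <= e / 6.
  have := key (- nrm f) (- nrm g); rewrite -/c => /(_ _ hg).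
  rewrite -opprD normrN; apply; lra.
apply: (@le_lt_trans _ _ (e / 2)); last by lra.
apply: tmdist_le => x.
have := key (- ((nrm f + f x) / 2)) (- ((nrm g + g x) / 2)).
have fx : c / 2 <= trace (Hin f) x by apply: le_trans (depth_le _ _); rewrite /= -/c; lra.
have gx : c / 2 <= trace (Hin g) x by apply: le_trans (depth_le _ _); rewrite /=; lra.
have := le_lt_trans (hmdist_ge (Hin f) (Hin g) x) fg; rewrite ltr_norml => fgx.
move=> /(_ fx gx fgx); move: n1; rewrite !ler_norml => /andP[? ?] /andP[? ?].
by apply/andP; lra.
Qed.

(** The trace of [Hin f] at [z] is the maximum over [y] of [weight f y * rho y z]. The weight is 1
    at [x], which gives the lower bound [rho x z]; it is at most [e] where [rho x y > d], because
    [weight f y * rho x y <= expR (- nrm f)]. Points [y] closer to [x] contribute at most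
    [rho x z + e]. *)
Lemma hat_far e : 0 < e -> exists2 c, 0 < c & forall f x, f x = nrm f ->
  expR (- nrm f) <= c -> mdist (Hin f) (Hbd x) <= e.
Proof.
move=> e0; have [d d0 hd] := rho_unif Z e0.
exists (d * e); first exact: mulr_gt0.
move=> f x fx fc; apply: hmdist_le => z.
have w1 : weight f x = 1 by rewrite /weight fx subrr mul0r oppr0 expR0.
have := weight_le_expprod f (Hbd z) x; rewrite w1 mul1r.
rewrite {1}/trace/= rhoC => lo; rewrite /trace/=.
rewrite ger0_norm ?subr_ge0// lerBlDr.
have [y hy] := expprod_attain f (Hbd z); rewrite /trace/= in hy.
rewrite -hy rhoC; have w0 := weight_gt0 f y; have wl := weight_le1 f y.
have [xy|xy] := leP (rho x y) d.
  have := hd _ _ xy z; rewrite ler_norml => /andP[h1 h2].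
  rewrite (@le_trans _ _ (rho y z))//; last by lra.
  by rewrite ler_piMl ?rho_ge0.
have we : weight f y * rho x y <= d * e.
  apply: le_trans fc; have := ap_adm_exp f x y.
  have -> : weight f y = expR (- nrm f) * expR ((f x + f y) / 2).
    by rewrite -expRD fx; congr expR; lra.
  by move=> h; rewrite -mulrA ler_piMr ?expR_ge0// mulrC.
have we1 : weight f y <= e.
  rewrite -(ler_pM2l d0) (le_trans _ we)// mulrC ler_wpM2l// ltW//.
rewrite (@le_trans _ _ e)//; last by rewrite lerDl rho_ge0.
by rewrite (le_trans _ we1)// ler_piMr ?rho_le1// ltW.
Qed.

(** An ultrafilter either keeps the depth away from 0, and converges in T(Z) by properness, or has
    depth tending to 0, and converges to the limit in Z of maximum points of its functions by
    [hat_far]. *)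
Lemma hat_compact : compact [set: H].
Proof.
rewrite compact_ultra => F UF _.
have [[c c0 Fc]|/forall2NP Fn] := pselect (exists2 c, 0 < c & F [set p | c <= depth p]).
  pose pr p := if p is Hin f then f else tzero Z.
  have Fb : F (pr @^-1` cball (tzero Z) (- ln c)).
    apply: filterS Fc => -[f|x] /=; last first.
      by move=> h; have := lt_le_trans c0 h; rewrite ltxx.
    rewrite /cball/= -/(nrm f) lerNr => h.
    by rewrite -(expRK (- nrm f)) ler_ln ?posrE ?expR_gt0.
  have [f _ Ff] := ultra_cvg_compact UF (ap_proper (x:=_) (r:=_)) Fb.
  exists (Hin f); split => //=.
  apply: (@cvg_mdist R (hat Z) _ F _ id) => e e0.
  apply: filterS (filterI Fc (cvg_mdist_lt _ Ff e0)) => -[g|x] /= [h1 h2].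
    exact: le_lt_trans (Hin_lip _ _) h2.
  by have := lt_le_trans c0 h1; rewrite ltxx.
have {}Fn c : 0 < c -> F [set p | depth p <= c].
  move=> c0; have [//|nF] := Fn c; have [//|] := in_ultra_setVsetC [set p | c <= depth p] UF.
  by apply: filterS => p /= /negP; rewrite -ltNge => /ltW.
pose pr p : Z := match p with Hin f => projT1 (cid (nrm_attain f)) | Hbd x => x end.
have [x hx] := rho_ultra (ultra_fmap pr UF).
exists (Hbd x); split => //=.
apply: (@cvg_mdist R (hat Z) _ F _ id) => e e0.
have e3 : 0 < e / 3 by lra.
have [c c0 hc] := hat_far e3; have [d d0 hd] := rho_unif Z e3.
have Fx : F [set p | rho x (pr p) <= d] := hx _ d0.
apply: filterS (filterI Fx (Fn _ c0)) => p /= [h1 h2].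
have k1 : mdist (Hbd x) (Hbd (pr p)) <= e / 3.
  by apply: hmdist_le => y; exact: hd.
have k2 : mdist (Hbd (pr p)) p <= e / 3.
  case: p h2 {h1 k1} => [f|y] h2 /=; last by rewrite mdistxx ltW.
  by case: cid => y hy /=; rewrite metric_sym; exact: hc.
by have := metric_triangle (Hbd x) (Hbd (pr p)) p; lra.
Qed.

Lemma nrm_ray x t : 0 <= t -> nrm (ray (tzero Z) x t) = t.
Proof.
move=> t0; apply/eqP; rewrite eq_le; apply/andP; split.
  have := ray_lip (tzero Z) x 0 t; rewrite ray0 sub0r normrN ger0_norm//.
by have := nrm_bound (ray (tzero Z) x t) x; rewrite ray_at//= add0r => /andP[].
Qed.

Lemma hat_dense : dense (range (@Hin R Z)).
Proof.
move=> O [p Op] oO; case: p Op => [f|x] Op; first by exists (Hin f); split => //; exists f.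
have : nbhs (Hbd x) O by exact: open_nbhs_nbhs.
move=> /nbhs_mdist_ex[e e0 he].
have e2 : 0 < e / 2 by lra.
have [c c0 hc] := hat_far e2.
pose t := Num.max 0 (- ln c); have t0 : 0 <= t by rewrite le_max lexx.
exists (Hin (ray (tzero Z) x t)); split; last by exists (ray (tzero Z) x t).
apply: he => /=; rewrite metric_sym; apply: (@le_lt_trans _ _ (e / 2)); last by lra.
apply: hc; first by rewrite nrm_ray// ray_at// add0r.
by rewrite nrm_ray// -[leRHS]lnK ?posrE// ler_expR lerNl le_max lexx orbT.
Qed.

Lemma Hin_open (U : set T) :
  open U <-> exists2 V : set H, open V & @Hin R Z @^-1` V = U.
Proof.
split=> [oU|[V oV <-]]; last by apply: open_comp => // f _; exact: Hin_continuous.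
exists (Hin @` U); last first.
  by apply/seteqP; split => [f [g Ug [<-]]//|f Uf]; exists f.
rewrite openE => _ [f Uf <-] /=.
have : nbhs f U by exact: open_nbhs_nbhs.
move=> /nbhs_mdist_ex[e e0 he].
have [d d0 hd] := Hin_inv f e0.
apply: filterS (nbhs_mdist (Hin f) d0) => p /hd[g -> fg].
by exists g => //; exact: he.
Qed.

(** This is [exp (- (p|q)_f)], by the change of base point [(p|q)_f = (p|q)_o + d(o, f) - (f|p)_o -
    (f|q)_o]. *)
Definition wprod f p q : R :=
  expprod p q * expR (- nrm f) / (expprod (Hin f) p * expprod (Hin f) q).

Lemma expprod_Hin_gt0 f p : 0 < expprod (Hin f) p.
Proof. by case: p => [g|x] /=; exact: expR_gt0. Qed.

Lemma wprod_ii f g h : wprod f (Hin g) (Hin h) = expR (- gromov_product f g h).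
Proof.
rewrite /wprod /= -!expRD -expRN -expRD; congr expR.
by rewrite /gromov_product (metric_sym g f) (metric_sym h f); lra.
Qed.

Lemma wprod_ib f g x : wprod f (Hin g) (Hbd x) =
  expR (- ((mdist f g + g x - f x) / 2)).
Proof. by rewrite /wprod /= -!expRD -expRN -expRD; congr expR; lra. Qed.

Lemma wprod_bb f x y : wprod f (Hbd x) (Hbd y) = rho x y * expR ((f x + f y) / 2).
Proof.
rewrite /wprod /= -!expRD -mulrA -expRN -expRD; congr (_ * expR _); lra.
Qed.

Lemma wprodC f p q : wprod f p q = wprod f q p.
Proof. by rewrite /wprod (expprodC p) (mulrC (expprod (Hin f) p)). Qed.

Lemma wprod_le1 f p q : wprod f p q <= 1.
Proof.
have H g x : wprod f (Hin g) (Hbd x) <= 1.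
  rewrite wprod_ib expR_le1; have := tmdist_geB f g x; lra.
case: p q => [g|x] [h|y] //; last 2 first.
- by rewrite wprodC.
- by rewrite wprod_bb ap_adm_exp.
rewrite wprod_ii expR_le1 /gromov_product.
by have := metric_triangle g f h; rewrite (metric_sym f h); lra.
Qed.

Lemma wprod_continuous f : continuous (fun pq : H * H => wprod f pq.1 pq.2).
Proof.
have ve : continuous (fun pq : H * H => expprod pq.1 pq.2).
  move=> [p q]; apply/(@cvgrPdist_lt _ _ (H * H)%type (nbhs (p, q)) _) => e e0 /=.
  have e2 : 0 < e / 2 by lra.
  exists ([set p' | mdist p p' < e / 2], [set q' | mdist q q' < e / 2]).
    by split; exact: nbhs_mdist.
  move=> [p' q'] /= [h1 h2].
  have := expprod_lip p q q'; have := expprod_lip q' p p'.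
  rewrite (expprodC q' p) (expprodC q' p') !ler_norml ltr_norml.
  by move=> /andP[? ?] /andP[? ?]; apply/andP; lra.
have v1 : continuous (expprod (Hin f)).
  by apply: continuous_mdistR => p e e0; exists e => // q; exact/le_lt_trans/expprod_lip.
move=> [p q]; apply: cvgM; first by apply: cvgM; [exact: (ve (p, q)) | exact: cvg_cst].
apply: cvgV; first by rewrite gt_eqF// mulr_gt0 ?expprod_Hin_gt0.
have c1 : continuous (fun pq : H * H => expprod (Hin f) pq.1).
  by move=> pq; apply: continuous_comp; [exact: cvg_fst | exact: v1].
have c2 : continuous (fun pq : H * H => expprod (Hin f) pq.2).
  by move=> pq; apply: continuous_comp; [exact: cvg_snd | exact: v1].
by apply: cvgM; [exact: c1 | exact: c2].
Qed.

End Hat.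

(** * The logarithm with values in the extended reals *)

Section ExtendedLog.
Context {R : realType}.
Local Open Scope ereal_scope.

Definition elog (r : R) : \bar R := if (r <= 0)%R then +oo else (- ln r)%R%:E.

Lemma elog_ge0 r : (r <= 1)%R -> 0 <= elog r.
Proof.
by move=> r1; rewrite /elog; case: ifP => // _; rewrite lee_fin oppr_ge0 ln_le0.
Qed.

Lemma elog_expR r : elog (expR r) = (- r)%R%:E.
Proof. by rewrite /elog leNgt expR_gt0/= expRK. Qed.

Lemma expeR_elog r : (0 <= r)%R -> expeR (- elog r) = r%:E.
Proof.
move=> r0; rewrite /elog; have [r1|r1] := leP r 0%R; last by rewrite /= opprK lnK.
by have -> : r = 0%R by apply/eqP; rewrite eq_le r1.
Qed.

Lemma elog_eqy r : (elog r = +oo) <-> (r <= 0)%R.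
Proof. by rewrite /elog; case: ifP. Qed.

Lemma elog_continuous : continuous elog.
Proof.
move=> r; rewrite /continuous_at; have [r0|r0] := leP r 0%R.
  have -> : elog r = +oo by rewrite /elog r0.
  apply/cvgeyPge => A; have rA : (r < expR (- A))%R by exact: le_lt_trans (expR_gt0 _).
  near=> s; have sA : (s < expR (- A))%R by near: s; exact: lt_nbhsl.
  rewrite /elog; case: (leP s 0%R) => s0; first by rewrite leey.
  by rewrite lee_fin lerNr -[leRHS]expRK ler_ln ?posrE ?expR_gt0// ltW.
have -> : elog r = (- ln r)%R%:E by rewrite /elog leNgt r0.
have near_r : {near r, (fun s : R => (- ln s)%R%:E) =1 elog}.
  by near=> s; rewrite /elog leNgt ifN// negbK; near: s; exact: lt_nbhsr.
apply: (cvg_trans (near_eq_cvg near_r)).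
apply: cvg_EFin; first by near=> s.
exact: cvgN (continuous_ln r0).
Unshelve. all: by end_near. Qed.

End ExtendedLog.

(** * The Gromov product space of an antipodal space *)

Section GpOfAntipodal.
Context {R : realType} (Z : antipodal R).
Notation T := (tspan (ap_span Z)).

Let ext (f : T) (p q : hat Z) : \bar R := elog (wprod f p q).

Let ext_emb (f g h : T) : ext f (Hin g) (Hin h) = (gromov_product f g h)%:E.
Proof. by rewrite /ext wprod_ii elog_expR opprK. Qed.

Let ext_ge0 f p q : (0 <= ext f p q)%E.
Proof. exact/elog_ge0/wprod_le1. Qed.

Let ext_continuous f : continuous (fun pq : hat Z * hat Z => ext f pq.1 pq.2).
Proof.
move=> pq; apply: (@continuous_comp _ _ _ (fun pq : hat Z * hat Z => wprod f pq.1 pq.2)).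
  exact: wprod_continuous.
exact: elog_continuous.
Qed.

Lemma notin_range_Hin (p : hat Z) : ~ range Hin p <-> exists x, p = Hbd x.
Proof.
split; last by move=> [x ->] [].
by case: p => [f []|x _]; [exists f | exists x].
Qed.

Let ext_oo f p q : ~ range Hin p -> ~ range Hin q ->
  (ext f p q = +oo%E <-> p = q).
Proof.
move=> /notin_range_Hin[x ->] /notin_range_Hin[y ->].
rewrite /ext elog_eqy wprod_bb pmulr_lle0 ?expR_gt0//; split.
  by move=> xy; congr Hbd; apply: rho_eq0; apply/eqP; rewrite eq_le xy rho_ge0.
by move=> [->]; rewrite rhoxx.
Qed.

Let four_points : (`I_4 #<= ~` range (@Hin R Z))%card.
Proof.
apply: card_le_trans (ap_four Z) _.
have <- : (@Hbd R Z @` setT) = ~` range (@Hin R Z).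
  apply/seteqP; split => p /=; first by move=> [x _ <-] [].
  by move=> /notin_range_Hin[x ->]; exists x.
have inj : {in [set: Z] &, injective (@Hbd R Z)} by move=> x y _ _ [].
by have := inj_card_eq inj; rewrite card_eq_le => /andP[].
Qed.

Let Hin_inj : injective (@Hin R Z). Proof. by move=> f g []. Qed.

Definition ap_gp : gp_space R :=
  GPSpace (@ap_proper R Z) (@tspan_geodesic R (ap_span Z)) (@ap_complete R Z)
    (@hat_compact R Z) (@metric_hausdorff R (hat Z))
    (compact_second_countable (@hat_compact R Z))
    Hin_inj
    (@Hin_open R Z) (@hat_dense R Z) ext_emb ext_ge0 ext_continuous ext_oo four_points.

End GpOfAntipodal.

(** * Boundaries of Gromov product spaces *)

Section Generalities.

Lemma ler_cvg_limits (R : realType) (T : Type) (F : set_system T) {FF : ProperFilter F}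
    (f g : T -> R) (a b : R) :
  f @ F --> a -> g @ F --> b -> F [set t | f t <= g t] -> a <= b.
Proof.
move=> fa gb fg; rewrite -subr_ge0.
have h : (fun t => g t - f t) @ F --> b - a by exact: cvgB.
rewrite -(cvg_lim (@Rhausdorff R) h); apply: limr_ge; first by apply/cvg_ex; exists (b - a).
by apply: filterS fg => t /=; rewrite subr_ge0.
Qed.

Lemma eq_cvg_limits (R : realType) (T : Type) (F : set_system T) {FF : ProperFilter F}
    (f g : T -> R) (a b : R) :
  f @ F --> a -> g @ F --> b -> F [set t | f t = g t] -> a = b.
Proof.
move=> fa gb fg; apply/eqP; rewrite eq_le.
by rewrite !(ler_cvg_limits fa gb, ler_cvg_limits gb fa)//;
  apply: filterS fg => t /= ->.
Qed.

Lemma fine_expeRN_continuous (R : realType) (e : \bar R) : (0 <= e)%E ->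
  {for e, continuous (fun a : \bar R => fine (expeR (- a)%E))}.
Proof.
case: e => [r _||//].
  rewrite /prop_for /continuous_at /=.
  have h : (fun s : R => expR (- s)) @ r --> expR (- r).
    by apply: continuous_comp; [exact: opp_continuous | exact: continuous_expR].
  by move=> A /h.
move=> _; rewrite /prop_for /continuous_at /=.
apply/(@cvgrPdist_lt _ _ _ (nbhs +oo%E) _) => d d0.
exists (- ln d); split; first exact: num_real.
move=> [s||] //=; last by rewrite sub0r normrN normr0.
rewrite lte_fin ltrNl sub0r normrN gtr0_norm ?expR_gt0// => sd.
by rewrite -[ltRHS]lnK ?posrE// ltr_expR.
Qed.

End Generalities.

Section GpFacts.
Context {R : realType} (X : gp_space R).
Implicit Types (x y z o : X) (p q : gp_hat X).
Notation B := (gp_boundary X).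
Notation emb := (@gp_emb R X).

Definition gpe x p q : R := fine (expeR (- gp_ext x p q)).

Lemma gpe_emb x y z : gpe x (emb y) (emb z) = expR (- gromov_product x y z).
Proof. by rewrite /gpe gp_ext_emb. Qed.

Lemma gpe_ge0 x p q : 0 <= gpe x p q.
Proof. by rewrite fine_ge0// expeR_ge0. Qed.

Lemma gpe_le1 x p q : gpe x p q <= 1.
Proof.
rewrite /gpe; have := gp_ext_ge0 x p q; case: (gp_ext x p q) => [r|_|//] /=.
  by rewrite lee_fin expR_le1 oppr_le0.
exact: ler01.
Qed.

Lemma gpe_eq0 x p q : gpe x p q = 0 <-> gp_ext x p q = +oo%E.
Proof.
rewrite /gpe; split=> [|->//]; have := gp_ext_ge0 x p q.
case: (gp_ext x p q) => [r|_|//] //= _ /eqP.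
by rewrite gt_eqF// expR_gt0.
Qed.

Lemma gpe_continuous x : continuous (fun pq : gp_hat X * gp_hat X => gpe x pq.1 pq.2).
Proof.
move=> pq; apply: (@continuous_comp _ _ _
  (fun pq : gp_hat X * gp_hat X => gp_ext x pq.1 pq.2)
  (fun a : \bar R => fine (expeR (- a)%E))).
  exact: gp_ext_continuous.
exact/fine_expeRN_continuous/gp_ext_ge0.
Qed.

Lemma gpe_cvg (T : Type) (F : set_system T) {FF : Filter F} x (u v : T -> gp_hat X) p q :
  u @ F --> p -> v @ F --> q -> (fun t => gpe x (u t) (v t)) @ F --> gpe x p q.
Proof.
move=> up vq; apply: (cvg_comp2 up vq).
exact: (@gpe_continuous x (p, q)).
Qed.

Lemma gpe_continuous1 x p : continuous (gpe x p).
Proof.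
move=> q; apply: (@gpe_cvg _ (nbhs q) _ x (cst p) id p q).
  exact: cvg_cst.
exact: cvg_id.
Qed.

Lemma gpe_continuous2 x q : continuous (gpe x ^~ q).
Proof.
move=> p; apply: (@gpe_cvg _ (nbhs p) _ x id (cst q) p q).
  exact: cvg_id.
exact: cvg_cst.
Qed.

Arguments gpe_cvg {T F FF} x {u v p q}.

Lemma gp_near_emb p : exists2 G : set_system X, UltraFilter G & emb @ G --> p.
Proof.
pose G0 := filter_from (nbhs p) (fun V => emb @^-1` V).
have PF : ProperFilter G0.
  apply: filter_from_proper.
    apply: filter_from_filter; first by exists setT; exact: filterT.
    by move=> V W Vp Wp; exists (V `&` W) => //; exact: filterI.
  move=> V; rewrite nbhsE => -[W [oW Wp] WV].
  have [z [Wz [y _ yE]]] := @gp_emb_dense R X W (ex_intro _ p Wp) oW.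
  by exists y; apply: WV; rewrite yE.
have [G [UG GG]] := ultraFilterLemma PF; exists G => //.
by move=> V Vp; apply: GG; exists V.
Qed.

(** Relations between Gromov products are checked on [X] and extended by density, one variable at a
    time. *)
Lemma gp_leR (f g : gp_hat X -> R) : continuous f -> continuous g ->
  (forall y, f (emb y) <= g (emb y)) -> forall p, f p <= g p.
Proof.
move=> cf cg fg p; have [G UG Gp] := gp_near_emb p.
apply: (ler_cvg_limits (cvg_comp _ _ Gp (cf p)) (cvg_comp _ _ Gp (cg p))).
by apply: filterE => y; exact: fg.
Qed.

Lemma gp_eqR (f g : gp_hat X -> R) : continuous f -> continuous g ->
  (forall y, f (emb y) = g (emb y)) -> forall p, f p = g p.
Proof.
move=> cf cg fg p; apply/eqP; rewrite eq_le; apply/andP; split.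
  by apply: gp_leR => // y; rewrite fg.
by apply: gp_leR => // y; rewrite fg.
Qed.

Lemma gpeC x p q : gpe x p q = gpe x q p.
Proof.
move: q; apply: gp_eqR; [exact: gpe_continuous1|exact: gpe_continuous2|move=> y].
move: p; apply: gp_eqR; [exact: gpe_continuous2|exact: gpe_continuous1|move=> z].
rewrite !gpe_emb /gromov_product (metric_sym y z); congr expR; lra.
Qed.

(** Change of base point, written as an identity of products so that both sides are continuous on
    the whole compactification. *)
Lemma gpe_base x y p q :
  gpe y p q * gpe x (emb y) p * gpe x (emb y) q = gpe x p q * expR (- mdist x y).
Proof.
move: q; apply: gp_eqR.
- move=> q; apply: cvgM; last exact: gpe_continuous1.
  by apply: cvgM; [exact: gpe_continuous1 | exact: cvg_cst].
- by move=> q; apply: cvgM; [exact: gpe_continuous1 | exact: cvg_cst].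
move=> z; move: p; apply: gp_eqR.
- move=> p; apply: cvgM; last exact: cvg_cst.
  by apply: cvgM; [exact: gpe_continuous2 | exact: gpe_continuous1].
- by move=> p; apply: cvgM; [exact: gpe_continuous2 | exact: cvg_cst].
move=> w; rewrite !gpe_emb -!expRD; congr expR; rewrite /gromov_product.
by rewrite (metric_sym y w) (metric_sym y z) (metric_sym y x); lra.
Qed.

(** Exponential form of the fact that Busemann functions are 1-Lipschitz. *)
Lemma gpe_shift o x y p :
  gpe o (emb y) p * expR ((mdist o y - mdist o x - mdist x y) / 2) <= gpe o (emb x) p.
Proof.
move: p; apply: gp_leR; last 1 first.
- move=> z; rewrite !gpe_emb -expRD ler_expR /gromov_product.
  have := metric_triangle y x z; rewrite (metric_sym y x) (metric_sym y o) (metric_sym x o).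
  lra.
- by move=> q; apply: cvgM; [exact: gpe_continuous1 | exact: cvg_cst].
- exact: gpe_continuous1.
Qed.

Lemma gpe_gt0 o x p : expR (- mdist o x) <= gpe o (emb x) p.
Proof.
move: p; apply: gp_leR; [move=> q; exact: cvg_cst|exact: gpe_continuous1|].
move=> z; rewrite gpe_emb ler_expR /gromov_product.
by have := metric_triangle o x z; rewrite (metric_sym o z) (metric_sym x o); lra.
Qed.

Lemma gpe_pos o x p : 0 < gpe o (emb x) p.
Proof. exact: lt_le_trans (expR_gt0 _) (gpe_gt0 _ _ _). Qed.

Lemma emb_continuous : continuous emb.
Proof. by apply/continuousP => V oV; apply/gp_emb_open; exists V. Qed.

Lemma gp_cvg_unique (T : Type) (F : set_system T) {FF : ProperFilter F}
  (u : T -> gp_hat X) p q : u @ F --> p -> u @ F --> q -> p = q.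
Proof. exact: (@cvg_unique _ (@gp_hat_hausdorff R X) (u @ F) _). Qed.

(** Properness makes [X] open in its compactification. An ideal point in an open [V] that cuts out
    the unit ball would lie in [V] minus the compact closed ball, an open set which misses [X] and
    so contradicts density. *)
Lemma gp_interior x : exists2 V : set (gp_hat X), nbhs (emb x) V &
  V `<=` range emb /\ emb @^-1` V = [set y | mdist x y < 1].
Proof.
have [V oV VE] := (gp_emb_open _).1 (open_mdist x 1).
have Vx : V (emb x) by have : (emb @^-1` V) x by rewrite VE /= mdistxx.
exists V; first exact: open_nbhs_nbhs.
split=> // p Vp; apply: contrapT => np.
have cK : closed (emb @` cball x 1).
  apply: compact_closed; first exact: gp_hat_hausdorff.
  apply: continuous_compact; last exact: gp_proper.
  exact/continuous_subspaceT/emb_continuous.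
have oW : open (V `&` ~` (emb @` cball x 1)).
  by apply: openI => //; exact: closed_openC.
have [] := @gp_emb_dense R X _ _ oW.
  by exists p; split=> // -[y _ yp]; apply: np; exists y.
move=> z [[Vz nKz] [y _ yE]]; apply: nKz; exists y => //.
have : (emb @^-1` V) y by rewrite /= yE.
by rewrite VE /cball /=; exact: ltW.
Qed.

Lemma bd_limit (T : Type) (F : set_system T) {FF : ProperFilter F}
    (u : T -> gp_hat X) p : u @ F --> p -> F [set t | ~ range emb (u t)] ->
  ~ range emb p.
Proof.
move=> up bu [x _ xp]; have [V Vx [VS _]] := gp_interior x.
rewrite xp in Vx; have FV : F (u @^-1` V) := up _ Vx.
have [t /= [h1 h2]] := filter_ex (filterI FV bu).
exact/h2/VS.
Qed.

Lemma escape_bd (T : Type) (F : set_system T) {FF : ProperFilter F}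
    (u : T -> X) o p : (fun t => emb (u t)) @ F --> p ->
  (forall r : R, F [set t | r < mdist o (u t)]) -> ~ range emb p.
Proof.
move=> up ho [x _ xp]; have [V Vx [_ VE]] := gp_interior x.
rewrite xp in Vx.
have FV : F ((fun t => emb (u t)) @^-1` V) := up _ Vx.
have [t /= [h1 h2]] := filter_ex (filterI FV (ho (mdist o x + 1))).
have : (emb @^-1` V) (u t) by [].
by rewrite VE /=; have := metric_triangle o x (u t); lra.
Qed.

Lemma bd_escape (T : Type) (F : set_system T) {UF : UltraFilter F}
    (u : T -> X) o p : (fun t => emb (u t)) @ F --> p -> ~ range emb p ->
  forall r : R, F [set t | r < mdist o (u t)].
Proof.
move=> up np r; have [//|Fr] := in_ultra_setVsetC [set t | r < mdist o (u t)] UF.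
exfalso; apply: np.
have Fb : F (u @^-1` cball o r).
  by apply: filterS Fr => t /= /negP; rewrite -leNgt.
have [x _ ux] := ultra_cvg_compact UF (gp_proper (x:=_) (r:=_)) Fb.
exists x => //; apply: (gp_cvg_unique _ up).
exact: cvg_comp ux (emb_continuous (x := x)).
Qed.

Lemma gp_hat_cvg (T : Type) (F : set_system T) (u : T -> gp_hat X) :
  UltraFilter F -> exists p, u @ F --> p.
Proof.
move=> UF; have FT : F (u @^-1` [set: gp_hat X]) by exact: filterT.
by have [p _ up] := ultra_cvg_compact UF (@gp_hat_compact R X) FT; exists p.
Qed.

Definition bd_of p (np : ~ range emb p) : B := exist _ p (mem_set np).

Lemma bdP (xi : B) : ~ range emb (val xi).
Proof. by case: xi => p /= /set_mem. Qed.

Arguments bdP : clear implicits.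

Lemma gp_boundary_four : (`I_4 #<= [set: B])%card.
Proof.
apply: card_le_trans (@gp_four_points R X) _.
by have := card_setT_sym (~` range emb); rewrite card_eq_le => /andP[].
Qed.

Variable o : X.

Let rho (xi eta : B) : R := visual o xi eta.

Let rhoE xi eta : rho xi eta = gpe o (val xi) (val eta). Proof. by []. Qed.

Let rhoC xi eta : rho xi eta = rho eta xi. Proof. exact: gpeC. Qed.

Let rhoxx xi : rho xi xi = 0.
Proof.
by apply/(gpe_eq0 o)/(gp_ext_oo o) => //; exact: bdP.
Qed.

Let rho_eq0 xi eta : rho xi eta = 0 -> xi = eta.
Proof.
rewrite rhoE gpe_eq0 => h; apply: val_inj.
by apply/(gp_ext_oo o) => //; exact: bdP.
Qed.

(** Prolong the geodesic from [x] to [y] backwards beyond [x] by its own length, to a point [z] with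
    [(y|z)_x = 0]. As [y] tends to [xi], the points [z] leave every ball, so their limit along an
    ultrafilter is ideal. *)
Lemma gp_antipode x (xi : B) : exists eta : B, gpe x (val xi) (val eta) = 1.
Proof.
have [G UG Gxi] := gp_near_emb (val xi).
have hz y : exists z, mdist x z = mdist x y /\ gromov_product x y z = 0.
  have [c [cg c0 cd]] := @gp_geodesic R X x y.
  have d0 := mdist_ge0 x y.
  have [c' [cg' c'E]] := @gp_complete R X _ _ _ d0 cg.
  have cE s t : mdist (c' s) (c' t) = `|s - t| by apply: cg'; rewrite inE.
  have x0 : c' 0 = x by rewrite c'E ?c0// in_itv/= lexx.
  have y0 : c' (mdist x y) = y by rewrite c'E ?cd// in_itv/= lexx d0.
  exists (c' (- mdist x y)); split.
    by rewrite -{1}x0 cE sub0r opprK ger0_norm.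
  have e1 : mdist (c' (- mdist x y)) x = mdist x y.
    by rewrite -{2}x0 cE subr0 normrN ger0_norm.
  have e2 : mdist y (c' (- mdist x y)) = mdist x y + mdist x y.
    by rewrite -{1}y0 cE opprK ger0_norm// addr_ge0.
  by rewrite /gromov_product e1 e2 (metric_sym y x); lra.
pose z y := projT1 (cid (hz y)).
have zd y : mdist x (z y) = mdist x y by have [] := projT2 (cid (hz y)).
have zg y : gromov_product x y (z y) = 0 by have [] := projT2 (cid (hz y)).
have [q zq] := gp_hat_cvg (fun y => emb (z y)) UG.
have nq : ~ range emb q.
  apply: (escape_bd zq (o := x)) => r.
  have Gr : G [set y | r < mdist x y].
    exact: (@bd_escape _ G UG id x _ Gxi (bdP xi) r).
  by apply: filterS Gr => y /=; rewrite zd.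
exists (bd_of nq) => /=.
have h1 : (fun y : X => 1 : R) @ G --> (1 : R) by exact: cvg_cst.
have h2 : (fun y => gpe x (emb y) (emb (z y))) @ G --> gpe x (val xi) q.
  exact: gpe_cvg.
apply: (eq_cvg_limits h2 h1).
by apply: filterE => y /=; rewrite gpe_emb zg oppr0 expR0.
Qed.

Let rho_ultra (F : set_system B) : UltraFilter F ->
  exists xi, forall e : R, 0 < e -> F [set eta | rho xi eta <= e].
Proof.
move=> UF; have [p Fp] := gp_hat_cvg (fun xi : B => val xi) UF.
have np : ~ range emb p.
  by apply: (bd_limit Fp); apply: filterE => xi; exact: bdP.
exists (bd_of np) => e e0.
have h : (fun eta : B => gpe o p (val eta)) @ F --> gpe o p p.
  exact: gpe_cvg (cvg_cst p) Fp.
have pp0 : gpe o p p = 0 by exact: (rhoxx (bd_of np)).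
rewrite pp0 in h; move/cvgrPdist_le : h => /(_ _ e0); apply: filterS => eta /=.
by rewrite sub0r normrN ger0_norm ?gpe_ge0.
Qed.

(** Violations for [d = 1 / (n + 1)] converge along an ultrafilter to ideal points [p], [q], [r];
    then [p = q], while the values at [(p, r)] and [(q, r)] differ by at least [e]. *)
Let rho_unif (e : R) : 0 < e -> exists2 d : R, 0 < d &
  forall xi xi', rho xi xi' <= d -> forall eta, `|rho xi eta - rho xi' eta| <= e.
Proof.
move=> e0; apply: contrapT => nd.
have h n : exists abc : B * B * B, rho abc.1.1 abc.1.2 <= n.+1%:R^-1 /\
    e <= `|rho abc.1.1 abc.2 - rho abc.1.2 abc.2|.
  apply: contrapT => nh; apply: nd; exists (n.+1%:R^-1); first by rewrite invr_gt0.
  move=> a b ab c; rewrite leNgt; apply/negP => /ltW abc.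
  by apply: nh; exists (a, b, c).
pose abc n := projT1 (cid (h n)).
have h1 n : rho (abc n).1.1 (abc n).1.2 <= n.+1%:R^-1 by have [] := projT2 (cid (h n)).
have h2 n : e <= `|rho (abc n).1.1 (abc n).2 - rho (abc n).1.2 (abc n).2|.
  by have [] := projT2 (cid (h n)).
have [G [UG GG]] := ultraFilterLemma eventually_filter.
have [p ap] := gp_hat_cvg (fun n => val (abc n).1.1) UG.
have [q bq] := gp_hat_cvg (fun n => val (abc n).1.2) UG.
have [r cr] := gp_hat_cvg (fun n => val (abc n).2) UG.
have np : ~ range emb p by apply: (bd_limit ap); apply: filterE => n; exact: bdP.
have nq : ~ range emb q by apply: (bd_limit bq); apply: filterE => n; exact: bdP.
have pq : p = q.
  apply/(gp_ext_oo o np nq)/gpe_eq0/eqP; rewrite eq_le gpe_ge0 andbT.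
  have inv0 : (fun n => n.+1%:R^-1 : R) @ G --> (0 : R).
    exact: cvg_trans (cvg_app _ GG) (@cvg_harmonic R).
  apply: (ler_cvg_limits (gpe_cvg o ap bq) inv0).
  by apply: filterE => n; exact: h1.
have : e <= `|gpe o p r - gpe o q r|.
  apply: (ler_cvg_limits (cvg_cst e) (cvg_norm (cvgB (gpe_cvg o ap cr) (gpe_cvg o bq cr)))).
  by apply: filterE => n; exact: h2.
by rewrite pq subrr normr0; lra.
Qed.

Definition bd_antipodal : antipodal R :=
  Antipodal (fun xi eta => gpe_ge0 o (val xi) (val eta))
    (fun xi eta => gpe_le1 o (val xi) (val eta))
    rhoC rhoxx rho_eq0 (gp_antipode o) rho_unif rho_ultra gp_boundary_four.

End GpFacts.

Arguments bdP {R X} xi _.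

(** * Moebius equivalent functions differ by a conformal factor *)

Section FourPoints.
Context (Z : Type).

Lemma card4_inj : (`I_4 #<= [set: Z])%card -> exists g : 'I_4 -> Z, injective g.
Proof.
move=> /card_leP[f].
pose i0 (i : 'I_4) : `I_4 := exist _ (val i) (mem_set (ltn_ord i)).
exists (fun i => val (f (i0 i))) => i j /val_inj ij.
have finj : {in [set: `I_4] &, injective f} := 'inj_f.
have e : i0 i = i0 j by apply: finj => //; rewrite inE.
by apply: val_inj; have := congr1 val e.
Qed.

Lemma card4_third (x y : Z) : (`I_4 #<= [set: Z])%card ->
  exists z, z <> x /\ z <> y.
Proof.
move=> /card4_inj[g ginj].
pose i (k : nat) (hk : (k < 4)%N) : 'I_4 := Ordinal hk.
pose a := g (i 0%N isT); pose b := g (i 1%N isT); pose c := g (i 2%N isT).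
have ab : a <> b by move=> /ginj.
have ac : a <> c by move=> /ginj.
have bc : b <> c by move=> /ginj.
have [ax|ax] := pselect (a = x); have [ay|ay] := pselect (a = y);
have [bx|bx] := pselect (b = x); have [by_|by_] := pselect (b = y);
  first [by exists a | by exists b | exists c; split; congruence].
Qed.

End FourPoints.

Section MoebiusFactor.
Context {R : realType} {Z : Type}.
Variables (r s : Z -> Z -> R).
Hypothesis four : (`I_4 #<= [set: Z])%card.
Hypothesis rC : forall x y, r x y = r y x.
Hypothesis sC : forall x y, s x y = s y x.
Hypothesis r0 : forall x y, x <> y -> 0 < r x y.
Hypothesis s0 : forall x y, x <> y -> 0 < s x y.
Hypothesis cross : forall x x' y y', x <> x' -> x <> y -> x <> y' -> x' <> y ->
  x' <> y' -> y <> y' -> cross_ratio s x x' y y' = cross_ratio r x x' y y'.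

Let L x y := ln (s x y) - ln (r x y).

Let LC x y : L x y = L y x. Proof. by rewrite /L rC sC. Qed.

Let ln_cross (t : Z -> Z -> R) x x' y y' : (forall x y, x <> y -> 0 < t x y) ->
  x <> y -> x <> y' -> x' <> y -> x' <> y' ->
  ln (cross_ratio t x x' y y') = ln (t x y) + ln (t x' y') - ln (t x y') - ln (t x' y).
Proof.
move=> t0 xy xy' x'y x'y'; rewrite /cross_ratio ln_div ?posrE ?mulr_gt0 ?t0//.
by rewrite !lnM ?posrE ?t0// opprD addrA.
Qed.

Let L4 x x' y y' : x <> x' -> x <> y -> x <> y' -> x' <> y ->
  x' <> y' -> y <> y' -> L x y + L x' y' = L x y' + L x' y.
Proof.
move=> h1 h2 h3 h4 h5 h6; have := cross h1 h2 h3 h4 h5 h6.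
by move=> /(congr1 (@ln R)); rewrite !ln_cross// /L; lra.
Qed.

(** If [L x y = (kappa x + kappa y) / 2] for [x <> y], this expression is [kappa x]. Equality of
    cross-ratios makes it independent of [a] and [b], so that it can serve as a definition of
    [kappa]. *)
Let phi x a b := L x a + L x b - L a b.

Let phiC x a b : phi x a b = phi x b a.
Proof. by rewrite /phi (LC a b); lra. Qed.

Let phi1 x a b c : x <> a -> x <> b -> x <> c -> a <> b -> a <> c ->
  phi x a b = phi x a c.
Proof.
move=> xa xb xc ab ac; have [->//|bc] := pselect (b = c).
by rewrite /phi; have := L4 xa xb xc ab ac bc; lra.
Qed.

Let phi2 x a b c d : x <> a -> x <> b -> x <> c -> x <> d -> a <> b -> c <> d ->
  phi x a b = phi x c d.
Proof.
move=> xa xb xc xd ab cd; have [ac|ac] := pselect (a = c).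
  by rewrite -ac in cd *; exact: phi1.
by rewrite (@phi1 x a b c)// phiC; apply: phi1 => // /esym.
Qed.

Lemma moebius_factor : exists kappa : Z -> R, forall x y, x <> y ->
  s x y = r x y * expR ((kappa x + kappa y) / 2).
Proof.
have h x : exists ab : Z * Z, [/\ x <> ab.1, x <> ab.2 & ab.1 <> ab.2].
  have [a [ax _]] := card4_third x x four; have [b [bx ba]] := card4_third x a four.
  by exists (a, b); split=> /esym.
pose ab x := projT1 (cid (h x)).
have abP x : [/\ x <> (ab x).1, x <> (ab x).2 & (ab x).1 <> (ab x).2].
  exact: projT2 (cid (h x)).
exists (fun x => phi x (ab x).1 (ab x).2) => x y xy.
have [z [zx zy]] := card4_third x y four.
have [x1 x2 x3] := abP x; have [y1 y2 y3] := abP y.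
have yx : y <> x by move/esym.
have xz : x <> z by move/esym.
have yz : y <> z by move/esym.
(* Both factors are computed with the same third point [z], whose contributions cancel in the
   sum. *)
rewrite (@phi2 x _ _ y z)// (@phi2 y _ _ x z)//.
have -> : (phi x y z + phi y x z) / 2 = ln (s x y) - ln (r x y).
  by rewrite /phi (LC y x) -/(L x y); lra.
by rewrite -ln_div ?posrE ?s0 ?r0// lnK ?posrE ?divr_gt0 ?s0 ?r0// mulrC divfK// gt_eqF ?r0.
Qed.

End MoebiusFactor.

(** * Busemann functions embed a space into the span of its boundary *)

Section GpToSpan.
Context {R : realType} (X : gp_space R) (o : X).
Notation B := (gp_boundary X).
Notation emb := (@gp_emb R X).
Notation Z := (bd_antipodal o).
Implicit Types (x y : X) (xi eta : B).

(** This is [2 (x|xi)_o - d(o, x)], that is the limit of [d(o, z) - d(x, z)] as [z] tends to [xi]: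
    zero at [o] and increasing towards [xi]. *)
Definition busemann x (xi : B) : R := - 2 * ln (gpe o (emb x) (val xi)) - mdist o x.

Lemma gpe_busemann x xi :
  gpe o (emb x) (val xi) = expR (- ((busemann x xi + mdist o x) / 2)).
Proof.
rewrite /busemann -[LHS]lnK ?posrE ?gpe_pos//; congr expR; lra.
Qed.

(** So [busemann x] is the logarithmic density of [visual x] with respect to [visual o]: it is
    admissible because [visual x <= 1], and tight because [visual x] has antipodes. *)
Lemma visual_busemann x xi eta :
  visual x xi eta = visual o xi eta * expR ((busemann x xi + busemann x eta) / 2).
Proof.
have := gpe_base o x (val xi) (val eta); rewrite !gpe_busemann -mulrA -expRD.
move=> /(canRL (mulfK (lt0r_neq0 (expR_gt0 _)))) h.
have vE z : visual z xi eta = gpe z (val xi) (val eta) by [].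
rewrite !vE h -mulrA -expRN -expRD; congr (_ * expR _); lra.
Qed.

Let bus_bounded x : bounded (busemann x : ap_span Z -> R).
Proof.
exists (mdist o x) => xi; rewrite /busemann ler_norml.
have g0 := gpe_pos o x (val xi).
have : ln (gpe o (emb x) (val xi)) <= 0 by rewrite ln_le0// gpe_le1.
have : - mdist o x <= ln (gpe o (emb x) (val xi)).
  by rewrite -[leLHS]expRK ler_ln ?posrE ?expR_gt0// gpe_gt0.
by move=> ? ?; apply/andP; lra.
Qed.

Let bus_adm x : admissible (busemann x : ap_span Z -> R).
Proof.
move=> xi eta /= xe; have r0 : 0 < visual o xi eta := rho_gt0 (Z := Z) xe.
have : visual x xi eta <= 1 by exact: gpe_le1.
by rewrite visual_busemann -{1}(lnK r0) -expRD expR_le1; lra.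
Qed.

Let bus_tight x : tight (busemann x : ap_span Z -> R).
Proof.
move=> xi e e0; have [eta h] := gp_antipode x xi.
have : visual x xi eta = 1 by [].
rewrite visual_busemann => h1.
have xe : xi <> eta.
  move=> xe; move: h1; rewrite xe.
  have -> : visual o eta eta = 0 := @rhoxx R Z eta.
  rewrite mul0r => /eqP.
  by rewrite eq_sym oner_eq0.
exists eta => //=; have := (@cap_expE _ Z xi eta _ xe).1 h1; lra.
Qed.

Definition gp_span x : tspan (ap_span Z) :=
  TSpan (bus_bounded x) (bus_adm x) (bus_tight x).

Lemma busemann_diff x y xi : busemann x xi - busemann y xi <= mdist x y.
Proof.
have := gpe_shift o x y (val xi); rewrite !gpe_busemann -expRD ler_expR; lra.
Qed.

(** Take the endpoint of the geodesic from [y] to [x] prolonged beyond [x]: on its points [z n] the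
    difference of the distances to [y] and to [x] is constantly [mdist y x]. *)
Lemma busemann_attain x y : exists xi, busemann x xi - busemann y xi = mdist x y.
Proof.
have [c [cg c0 cd]] := @gp_geodesic R X y x.
have d0 := mdist_ge0 y x.
have [c' [cg' c'E]] := @gp_complete R X _ _ _ d0 cg.
have cE s t : mdist (c' s) (c' t) = `|s - t| by apply: cg'; rewrite inE.
have x0 : c' 0 = y by rewrite c'E ?c0// in_itv/= lexx.
have y0 : c' (mdist y x) = x by rewrite c'E ?cd// in_itv/= lexx d0.
have [G [UG GG]] := ultraFilterLemma eventually_filter.
pose z n := c' (mdist y x + n%:R).
have zy n : mdist y (z n) = mdist y x + n%:R.
  by rewrite /z -{1}x0 cE sub0r normrN ger0_norm// addr_ge0.
have zx n : mdist x (z n) = n%:R.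
  by rewrite /z -{1}y0 cE opprD addrA subrr sub0r normrN ger0_norm.
have [p zp] := gp_hat_cvg (fun n => emb (z n)) UG.
have np : ~ range emb p.
  apply: (escape_bd (o := x) zp) => t.
  suff : \forall n \near \oo, t < mdist x (z n) by exact: GG.
  near=> n; rewrite zx; near: n; exact: nbhs_infty_gtr.
exists (bd_of np).
have : gpe o (emb y) p * expR ((mdist o y - mdist o x - mdist x y) / 2) = gpe o (emb x) p.
  have hz w : (fun n => gpe o (emb w) (emb (z n))) @ G --> gpe o (emb w) p.
    by apply: gpe_cvg => //; exact: cvg_cst.
  pose k := expR ((mdist o y - mdist o x - mdist x y) / 2).
  have hk : (fun n => gpe o (emb y) (emb (z n)) * k) @ G --> gpe o (emb y) p * k.
    by apply: cvgM => //; exact: cvg_cst.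
  apply: (eq_cvg_limits hk (hz x)); rewrite /k.
  apply: filterE => n /=; rewrite !gpe_emb -expRD; congr expR; rewrite /gromov_product.
  have := zx n; have := zy n; rewrite (metric_sym x y) (metric_sym x o) (metric_sym y o).
  lra.
rewrite -[p]/(val (bd_of np)) !gpe_busemann -expRD => /expR_inj; lra.
Unshelve. all: by end_near. Qed.

Lemma gp_span_iso x y : mdist (gp_span x) (gp_span y) = mdist x y.
Proof.
apply/eqP; rewrite eq_le; apply/andP; split.
  by apply: tmdist_leB => xi; exact: busemann_diff.
by have [xi <-] := busemann_attain x y; exact: (tmdist_geB (gp_span x) (gp_span y)).
Qed.

End GpToSpan.

(** * Maximality *)

Lemma cross_ratio_conformal (R : realType) (Z : Type) (r s : Z -> Z -> R) (k : Z -> R) :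
  (forall x y, s x y = r x y * expR ((k x + k y) / 2)) ->
  forall x x' y y', cross_ratio s x x' y y' = cross_ratio r x x' y y'.
Proof.
move=> h x x' y y'; rewrite /cross_ratio !h.
set c := expR ((k x + k x' + k y + k y') / 2).
have -> : r x y * expR ((k x + k y) / 2) * (r x' y' * expR ((k x' + k y') / 2)) =
    r x y * r x' y' * c.
  by rewrite mulrACA -expRD; congr (_ * expR _); lra.
have -> : r x y' * expR ((k x + k y') / 2) * (r x' y * expR ((k x' + k y) / 2)) =
    r x y' * r x' y * c.
  by rewrite mulrACA -expRD; congr (_ * expR _); lra.
by rewrite -mulf_div divff ?mulr1// gt_eqF// expR_gt0.
Qed.

Section ApBoundary.
Context {R : realType} (Z : antipodal R).
Implicit Types (f : ap_gp Z) (p q : hat Z).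
Notation B := (gp_boundary (ap_gp Z)).

Lemma wprod_ge0 f p q : 0 <= wprod f p q.
Proof.
by rewrite divr_ge0 ?mulr_ge0 ?expR_ge0 ?(ltW (expprod_Hin_gt0 _ _))//;
  case: p q => [g|x] [h|y] /=; rewrite ?expR_ge0 ?rho_ge0.
Qed.

Lemma gpe_ap f p q : @gpe R (ap_gp Z) f p q = wprod f p q.
Proof. by rewrite /gpe /= expeR_elog ?wprod_ge0. Qed.

Definition bd_pt p : Z := if p is Hbd x then x else ap_base Z.

Lemma Hbd_notin (x : Z) : ~ range (@gp_emb R (ap_gp Z)) (Hbd x : gp_hat (ap_gp Z)).
Proof. by move=> []. Qed.

Definition to_bd (x : Z) : B := bd_of (@Hbd_notin x).

Lemma val_to_bd x : val (to_bd x) = Hbd x. Proof. by []. Qed.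

Lemma bd_ptK (xi : B) : Hbd (bd_pt (val xi)) = val xi.
Proof. by have /notin_range_Hin[x ->] := bdP xi. Qed.

Lemma to_bdK (xi : B) : to_bd (bd_pt (val xi)) = xi.
Proof. by apply: val_inj; rewrite val_to_bd bd_ptK. Qed.

Lemma visual_ap f (xi eta : B) : visual f xi eta =
  rho (bd_pt (val xi)) (bd_pt (val eta)) *
  expR ((f (bd_pt (val xi)) + f (bd_pt (val eta))) / 2).
Proof.
have -> : visual f xi eta = @gpe R (ap_gp Z) f (val xi) (val eta) by [].
by rewrite gpe_ap -{1}(bd_ptK xi) -{1}(bd_ptK eta) wprod_bb.
Qed.

(** A trace has maximum 1, so proportional traces are equal; this normalization is used for the
    continuity of extended maps. *)
Lemma trace_attain1 p : exists x, trace p x = 1.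
Proof.
case: p => [f|x].
  have [x hx] := nrm_attainN f; exists x.
  by rewrite /trace /= hx subrr mul0r oppr0 expR0.
by have [y xy] := rho_antipode x; exists y.
Qed.

End ApBoundary.

Section Continuity.

Lemma ultra_continuous (T U : topologicalType) (f : T -> U) :
  (forall (F : set_system T) x, UltraFilter F -> F --> x -> f @ F --> f x) ->
  continuous f.
Proof.
move=> h x V Vfx; apply: contrapT => nV.
have PF : ProperFilter (within (f @^-1` (~` V)) (nbhs x)).
  apply: Build_ProperFilter_ex => A; rewrite /within => nA.
  apply: contrapT => A0; apply: nV; rewrite /=.
  suff : nbhs x (f @^-1` V) by [].
  have {}nA : nbhs x [set y | (~` V) (f y) -> A y] := nA.
  apply: filterS nA => y /= yA.
  by apply: contrapT => nVy; apply: A0; exists y; exact: yA.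
have [G [UG GG]] := ultraFilterLemma PF.
have Gx : G --> x.
  by move=> A Ax; apply: GG; apply: filterS Ax => y /=.
have GV : G (f @^-1` V) := h _ _ UG Gx V Vfx.
have GnV : G (f @^-1` (~` V)) by apply: GG; exact: withinT.
by have [y /= []] := filter_ex (filterI GV GnV).
Qed.

Lemma cvg_set_type (T : Type) (U : topologicalType) (A : set U)
    (F : set_system T) {FF : Filter F} (f : T -> A) (x : A) :
  (fun t => val (f t)) @ F --> val x -> f @ F --> x.
Proof.
move=> h V; rewrite nbhsE => -[W [[W' oW' WE] Wx] WV].
have : nbhs (val x) W' by apply: open_nbhs_nbhs; split => //; move: Wx; rewrite -WE.
move=> /h FW; suff : F (f @^-1` V) by [].
have {}FW : F ((fun t => val (f t)) @^-1` W') by exact: FW.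
by apply: filterS FW => t /= Wt; apply: WV; rewrite -WE.
Qed.

Lemma val_cvg (U : topologicalType) (A : set U) (F : set_system A) (x : A) :
  F --> x -> (fun t : A => val t) @ F --> val x.
Proof.
move=> Fx V Vx; apply: Fx.
exact: (@initial_continuous A U set_val x V Vx).
Qed.

End Continuity.

Section ExtensionIsometry.
Context {R : realType} (Y X : gp_space R).

Lemma gpe_extension (F : Y -> X) (Fhat : gp_hat Y -> gp_hat X) :
  isometric_embedding F -> continuous Fhat ->
  (forall y, Fhat (gp_emb y) = gp_emb (F y)) ->
  forall y p q, gpe (F y) (Fhat p) (Fhat q) = gpe y p q.
Proof.
move=> Fi Fc FE y p q; move: q; apply: gp_eqR.
- by move=> q; apply: continuous_comp; [exact: Fc | exact: gpe_continuous1].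
- exact: gpe_continuous1.
move=> z; move: p; apply: gp_eqR.
- move=> p; apply: (@continuous_comp _ _ _ Fhat (gpe (F y) ^~ (Fhat (gp_emb z)))).
    exact: Fc.
  exact: gpe_continuous2.
- exact: gpe_continuous2.
by move=> w; rewrite !FE !gpe_emb /gromov_product !Fi.
Qed.

End ExtensionIsometry.

Section MaximalIso.
Context {R : realType} (X : gp_space R) (o : X).
Notation Z := (bd_antipodal o).
Notation T := (tspan (ap_span Z)).
Notation Y := (ap_gp Z).

(** Both boundaries have the points of [Z], and [g] is the identity on them; what must be proved is
    that the two subspace topologies agree. *)
Let g (xi : gp_boundary Y) : gp_boundary X := bd_pt (val xi).

Let g_continuous : continuous g.
Proof.
apply: ultra_continuous => F xi UF /val_cvg Fxi; apply: cvg_set_type.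
have [p gp] := gp_hat_cvg (fun t => val (g t)) UF.
have np : ~ range (@gp_emb R X) p.
  by apply: (bd_limit gp); apply: filterE => t; exact: bdP.
suff -> : val (g xi) = p by [].
have h : (fun t => gpe o (val (g xi)) (val (g t))) @ F --> gpe o (val (g xi)) p.
  by apply: gpe_cvg => //; exact: cvg_cst.
apply/(gp_ext_oo o (bdP (g xi)) np)/(gpe_eq0 o).
apply/eqP; rewrite eq_le gpe_ge0 andbT; apply/ler_addgt0Pl => e e0; rewrite addr0.
apply: (ler_cvg_limits h (cvg_cst e)).
have : F [set t : gp_boundary Y | mdist (val xi : hat Z) (val t) < e].
  exact: (@cvg_mdist_lt R (hat Z) _ F _ (fun t : gp_boundary Y => val t) _ _ Fxi e0).
apply: filterS => t /= ht.
have := le_lt_trans (hmdist_ge (val xi : hat Z) (val t) (g xi)) ht.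
have -> : trace (val xi : hat Z) (g xi) = 0.
  by rewrite -{1}bd_ptK /trace /=; exact: (@rhoxx R Z (g xi)).
have -> : trace (val t : hat Z) (g xi) = @rho R Z (g t) (g xi).
  by rewrite -{1}bd_ptK.
rewrite sub0r normrN ger0_norm; last exact: (@rho_ge0 R Z).
by rewrite (@rhoC R Z) => /ltW.
Qed.

Let h_continuous : continuous (@to_bd R Z : gp_boundary X -> gp_boundary Y).
Proof.
apply: ultra_continuous => F x UF /val_cvg Fx; apply: cvg_set_type.
apply: (@cvg_mdist R (hat Z) _ F _ (fun t : gp_boundary X => Hbd (t : Z)) (Hbd (x : Z))) => e e0.
have e2 : 0 < e / 2 by lra.
have [d d0 hd] := rho_unif Z e2.
have h : (fun t : gp_boundary X => gpe o (val x) (val t)) @ F --> gpe o (val x) (val x).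
  by apply: gpe_cvg => //; exact: cvg_cst.
have xx : gpe o (val x) (val x) = 0 by exact: (@rhoxx R Z x).
rewrite xx in h; move/cvgrPdist_le : h => /(_ _ d0); apply: filterS => t /=.
rewrite sub0r normrN ger0_norm ?gpe_ge0// => xt.
by apply: (@le_lt_trans _ _ (e / 2)); [apply: hmdist_le => z; exact: (hd x t) | lra].
Qed.

(** The embedding [F] given by maximality preserves visual functions, so [gp_span o] is a left
    inverse of [F]. Since [gp_span o] is itself injective, being isometric, [F] is onto. *)
Lemma maximal_onto : maximal_gp_space X ->
  exists2 F : T -> X, isometric_embedding F & forall x, exists f, F f = x.
Proof.
move=> mX.
have gm : boundary_moebius g.
  move=> f x; split.
    exists (@to_bd R Z); split; [exact: to_bdK|by []|exact: g_continuous|].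
    exact: h_continuous.
  move=> xi xi' eta eta' _.
  have -> : cross_ratio (visual f) xi xi' eta eta' =
      cross_ratio (fun a b : gp_boundary Y => visual o (g a) (g b)) xi xi' eta eta'.
    apply: (cross_ratio_conformal (k := fun a => f (g a))) => a b.
    exact: visual_ap.
  rewrite [LHS](_ : _ = cross_ratio (visual o) (g xi) (g xi') (g eta) (g eta'))//.
  by apply: (cross_ratio_conformal (k := busemann o x)) => a b; exact: visual_busemann.
have [F Fi [Fhat [Fc FE Fb]]] := mX Y g gm.
exists F => // x.
have key f : gp_span o (F f) = f.
  have h (a b : Z) : a <> b -> gp_span o (F f) a + gp_span o (F f) b = f a + f b.
    move=> ab.
    have := gpe_extension Fi Fc FE f (Hbd a) (Hbd b).
    have := Fb (to_bd a); have := Fb (to_bd b); rewrite !val_to_bd => -> ->.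
    have -> : gpe (F f) (val (g (to_bd a))) (val (g (to_bd b))) = visual (F f) a b by [].
    rewrite (visual_busemann o) gpe_ap wprod_bb => /(mulfI _) eab.
    have : expR ((busemann o (F f) a + busemann o (F f) b) / 2) = expR ((f a + f b) / 2).
      by apply: eab; rewrite gt_eqF//; exact: (@rho_gt0 R Z a b).
    by move=> /expR_inj /=; lra.
  apply: tspan_eq => a.
  (* Only sums over two distinct points are known; the three sums over [a], [b], [c] determine the
     value at [a]. *)
  have [b [ba _]] := card4_third a a (ap_four Z).
  have [c [ca cb]] := card4_third a b (ap_four Z).
  have := h b a ba; have := h c a ca; have := h c b cb; lra.
exists (gp_span o x); apply/mdist_positivity.
by rewrite -(gp_span_iso o) key mdistxx.
Qed.

End MaximalIso.

(** * Maximality for a finite boundary *)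

Section FiniteMaximal.
Context {R : realType} (Z : antipodal R) (n : nat) (a : 'I_n -> Z).
Hypothesis a_onto : forall x, exists i, a i = x.
Notation T := (tspan (ap_span Z)).

Lemma fin_bounded (k : Z -> R) : bounded k.
Proof.
exists (\sum_(i < n) `|k (a i)|) => x; have [i <-] := a_onto x.
by rewrite (bigD1 i)//= lerDl sumr_ge0.
Qed.

Lemma gpe_basepoint (Y : gp_space R) (z0 : Y) p : gpe z0 (gp_emb z0) p = 1.
Proof.
move: p; apply: gp_eqR; [exact: gpe_continuous1|move=> q; exact: cvg_cst|move=> y].
by rewrite gpe_emb /gromov_product mdistxx (metric_sym z0) add0r subrr mul0r oppr0 expR0.
Qed.

Lemma finite_maximal : maximal_gp_space (ap_gp Z).
Proof.
move=> Y g gm.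
have [c _] := card4_inj (gp_boundary_four Y); pose xi0 := c ord0.
have [G UG _] := gp_near_emb (val xi0); have [z0 _] := filter_ex (@filterT _ G _).
have [[h [gK hK gc hc]] gcross] := gm z0 (tzero Z).
pose ga (xi : gp_boundary Y) : Z := bd_pt (val (g xi)).
pose ha (x : Z) : gp_boundary Y := h (to_bd x).
have gaK xi : ha (ga xi) = xi by rewrite /ha /ga to_bdK gK.
have haK x : ga (ha x) = x by rewrite /ha /ga hK.
have ga_inj : injective ga by exact: can_inj gaK.
have [kap hkap] : exists kappa : gp_boundary Y -> R, forall xi eta, xi <> eta ->
    rho (ga xi) (ga eta) = visual z0 xi eta * expR ((kappa xi + kappa eta) / 2).
  apply: moebius_factor.
  - exact: ap_four (bd_antipodal z0).
  - exact: (@rhoC R (bd_antipodal z0)).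
  - by move=> xi eta; exact: rhoC.
  - exact: (@rho_gt0 R (bd_antipodal z0)).
  - by move=> xi eta xe; apply: rho_gt0 => /ga_inj.
  move=> xi xi' eta eta' h1 h2 h3 h4 h5 h6.
  rewrite -gcross; last first.
    by rewrite /= !inE !negb_or; do ![apply/andP; split] => //; apply/eqP.
  have hs (b b' : gp_boundary Y) : visual (tzero Z : ap_gp Z) (g b) (g b') =
      rho (ga b) (ga b') * expR ((0 + 0) / 2) by rewrite visual_ap.
  exact: esym (cross_ratio_conformal (k := fun _ : gp_boundary Y => 0 : R) hs xi xi' eta eta').
(* The density of [visual y], transported to [Z], with respect to [rho]: both are compared with
   [visual z0], through [busemann] and [kap]. *)
pose F0 (y : Y) (x : Z) : R := busemann z0 y (ha x) - kap (ha x).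
have F0_vis y x x' : x <> x' ->
    visual y (ha x) (ha x') = rho x x' * expR ((F0 y x + F0 y x') / 2).
  move=> xx'; have hx : ha x <> ha x' by move=> /(congr1 ga); rewrite !haK.
  have := hkap _ _ hx; rewrite !haK => ->; rewrite (visual_busemann z0).
  by rewrite -mulrA -expRD; congr (_ * expR _); rewrite /F0; lra.
have F0_bounded y : bounded (F0 y : ap_span Z -> R) by exact: fin_bounded.
have F0_adm y : admissible (F0 y : ap_span Z -> R).
  move=> x x' /= xx'; have r0 := rho_gt0 xx'.
  have : visual y (ha x) (ha x') <= 1 by exact: gpe_le1.
  by rewrite F0_vis// -{1}(lnK r0) -expRD expR_le1; lra.
have F0_tight y : tight (F0 y : ap_span Z -> R).
  move=> x e e0; have [eta heta] := gp_antipode y (ha x).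
  have h1 : visual y (ha x) (ha (ga eta)) = 1 by rewrite gaK.
  have xe : x <> ga eta.
    move=> xe; have : visual y (ha x) (ha x) = 1 by rewrite {2}xe.
    have -> : visual y (ha x) (ha x) = 0 := @rhoxx R (bd_antipodal y) (ha x).
    by move/eqP; rewrite eq_sym oner_eq0.
  rewrite F0_vis// in h1.
  by exists (ga eta) => //=; have := (cap_expE _ xe).1 h1; lra.
pose F (y : Y) : T := TSpan (F0_bounded y) (F0_adm y) (F0_tight y).
have Fi : isometric_embedding F.
  move=> y y'; apply/eqP; rewrite eq_le; apply/andP; split.
    apply: tmdist_leB => x /=; rewrite /F0.
    by have := busemann_diff z0 y y' (ha x); lra.
  have [xi hxi] := busemann_attain z0 y y'.
  have := tmdist_geB (F y) (F y') (ga xi); rewrite /= /F0 gaK -hxi; lra.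
exists F => //.
pose isin (p : gp_hat Y) := exists y, gp_emb y = p.
pose Fhat (p : gp_hat Y) : hat Z :=
  match pselect (isin p) with
  | left h => Hin (F (projT1 (cid h)))
  | right h => Hbd (ga (bd_of (fun k => let: ex_intro2 y _ e := k in h (ex_intro _ y e))))
  end.
have FhatE y : Fhat (gp_emb y) = Hin (F y).
  rewrite /Fhat; case: pselect => [k|[]]; last by exists y.
  by case: cid => y' /= /gp_emb_inj ->.
have Fhatb xi : Fhat (val xi) = Hbd (ga xi).
  rewrite /Fhat; case: pselect => [k|k].
    by case: (bdP xi); case: k => y yE; exists y.
  by congr (Hbd (ga _)); exact: val_inj.
pose W p x := gpe z0 p (val (ha x)).
pose k x := trace (Hin (F z0)) x.
(* The trace of [Fhat p] is [k * W p] divided by its maximum, so that the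
   continuity of [W] gives that of [Fhat]. *)
have Wk p : exists2 C, 0 < C & forall x, k x * W p x = C * trace (Fhat p) x.
  have F0z0 x : F0 z0 x = - kap (ha x).
    by rewrite /F0 /busemann gpe_basepoint ln1 mdistxx; lra.
  have [[y yp]|np] := pselect (isin p).
    exists (expR (- ((nrm (F z0) + mdist z0 y - nrm (F y)) / 2))); first exact: expR_gt0.
    move=> x; rewrite -yp FhatE /k /W gpe_busemann /trace /= -!expRD; congr expR.
    by rewrite F0z0 /F0; lra.
  have np' : ~ range (@gp_emb R Y) p by move=> [y _ yp]; apply: np; exists y.
  pose xi := bd_of np'.
  exists (expR ((F z0 (ga xi) - nrm (F z0)) / 2)); first exact: expR_gt0.
  move=> x; rewrite -[p]/(val xi) Fhatb /k /W /trace /=.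
  have [xx|xx] := pselect (ga xi = x).
    rewrite -xx gaK rhoxx mulr0.
    have -> : gpe z0 (val xi) (val xi) = 0 := @rhoxx R (bd_antipodal z0) xi.
    by rewrite mulr0.
  have -> : gpe z0 p (val (ha x)) = visual z0 (ha (ga xi)) (ha x) by rewrite gaK.
  rewrite F0_vis//.
  rewrite mulrC -mulrA -expRD mulrC; congr (expR _ * _) => /=; lra.
exists Fhat; split; last 2 first.
- exact: FhatE.
- by move=> xi; rewrite Fhatb bd_ptK.
have Wc x : continuous (fun p => k x * W p x).
  by move=> p; apply: cvgM; [exact: cvg_cst | exact: gpe_continuous2].
move=> p; apply: (@cvg_mdist R (hat Z) _ (nbhs p) _ Fhat) => e e0.
have [C C0 hC] := Wk p.
(* The traces multiplied by [C] will differ by at most [2 * d = C * e / 2]: one [d] for the products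
   [k * W], one for the normalizing factors [C] and [D], which are compared where a trace equals
   1. *)
pose d := C * e / 4; have d0 : 0 < d by rewrite divr_gt0// mulr_gt0.
have near_all : nbhs p [set q | forall i, `|k (a i) * W p (a i) - k (a i) * W q (a i)| <= d].
  have := @filter_forall _ _
    (fun i => [set q | `|k (a i) * W p (a i) - k (a i) * W q (a i)| <= d]) (nbhs p) _.
  apply => i.
  by have /(@cvgrPdist_le _ _ _ (nbhs p) _) /(_ _ d0) := Wc (a i) p.
apply: filterS near_all => q hq /=.
have {}hq x : `|k x * W p x - k x * W q x| <= d by have [i <-] := a_onto x.
have [D D0 hD] := Wk q.
have CD : C - D <= d.
  have [x hx] := trace_attain1 (Fhat p); have := hq x.
  rewrite hC hD hx mulr1 ler_norml => /andP[_]; have := trace_le1 (Fhat q) x.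
  by have := trace_ge0 (Fhat q) x; nra.
have DC : D - C <= d.
  have [x hx] := trace_attain1 (Fhat q); have := hq x.
  rewrite hC hD hx mulr1 ler_norml => /andP[+ _]; have := trace_le1 (Fhat p) x.
  by have := trace_ge0 (Fhat p) x; nra.
apply: (@le_lt_trans _ _ (e / 2)); last by lra.
apply: hmdist_le => x; have := hq x; rewrite hC hD !ler_norml => /andP[h1 h2].
set tp := trace _ _ in h1 h2 *; set tq := trace _ _ in h1 h2 *.
have tq0 : 0 <= tq := trace_ge0 _ _; have tq1 : tq <= 1 := trace_le1 _ _.
have hd : d * 4 = C * e by rewrite /d; lra.
rewrite -(ler_pM2l C0) -[X in _ && X](ler_pM2l C0).
by apply/andP; split; nra.
Qed.

End FiniteMaximal.

(** * Polyhedral structure of finite spans *)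

Lemma fin_pos_min (R : realFieldType) (I : finType) (P : I -> R -> Prop) :
  (forall i, exists2 d : R, 0 < d & forall t, 0 < t <= d -> P i t) ->
  exists2 d : R, 0 < d & forall i t, 0 < t <= d -> P i t.
Proof.
move=> h; suff [d d0 hd] : exists2 d : R, 0 < d & forall i, i \in enum I ->
    forall t, 0 < t <= d -> P i t.
  by exists d => // i t; apply: hd; rewrite mem_enum.
elim: (enum I) => [|i s [d d0 hd]]; first by exists 1.
have [d' d'0 hd'] := h i; exists (Num.min d d'); first by rewrite lt_min d0.
move=> j; rewrite inE => /predU1P[->|js] t; rewrite le_min => /and3P[t0 td td'].
  by apply: hd'; rewrite t0.
by apply: hd => //; rewrite t0.
Qed.

Section Dot.
Context {R : realType} (m : nat).
Implicit Types (a x y : 'rV[R]_m).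

Lemma dotvDl a b x : dotv (a + b) x = dotv a x + dotv b x.
Proof. by rewrite /dotv -big_split; apply: eq_bigr => j _; rewrite mxE mulrDl. Qed.

Lemma dotvNl a x : dotv (- a) x = - dotv a x.
Proof. by rewrite /dotv -sumrN; apply: eq_bigr => j _; rewrite mxE mulNr. Qed.

Lemma dotv0l x : dotv 0 x = 0.
Proof. by rewrite /dotv big1// => j _; rewrite mxE mul0r. Qed.

Lemma dotvDr a x y : dotv a (x + y) = dotv a x + dotv a y.
Proof. by rewrite /dotv -big_split; apply: eq_bigr => j _; rewrite mxE mulrDr. Qed.

Lemma dotvZr a (t : R) x : dotv a (t *: x) = t * dotv a x.
Proof. by rewrite /dotv mulr_sumr; apply: eq_bigr => j _; rewrite mxE mulrCA. Qed.

Lemma dotv_suml (I : finType) (A : pred I) (a : I -> 'rV[R]_m) x :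
  dotv (\sum_(i | A i) a i) x = \sum_(i | A i) dotv (a i) x.
Proof.
by elim/big_rec2: _ => [|i u v _ <-]; [exact: dotv0l | rewrite dotvDl].
Qed.

Definition pairv (i j : 'I_m) : 'rV[R]_m := delta_mx 0 i + delta_mx 0 j.

Lemma dotv_pairv i j x : dotv (pairv i j) x = x 0 i + x 0 j.
Proof.
have d k : dotv (delta_mx 0 k) x = x 0 k.
  rewrite /dotv (bigD1 k)//= mxE !eqxx mul1r big1 ?addr0// => l lk.
  by rewrite mxE (negPf lk) andbF mul0r.
by rewrite dotvDl !d.
Qed.

Lemma convex_polyhedron_fin (I : finType) (a : I -> 'rV[R]_m) (b : I -> R) :
  convex_polyhedron [set x | forall i, dotv (a i) x <= b i].
Proof.
exists #|I|, (fun k => a (enum_val k)), (fun k => b (enum_val k)).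
apply/seteqP; split => x /= h i; first exact: h.
by have := h (enum_rank i); rewrite enum_rankK.
Qed.

End Dot.

Section LinfComplex.
Context {R : realType} (S : span_data R) (m : nat) (c : 'I_m -> S) (c' : S -> 'I_m).
Hypotheses (cK : cancel c c') (cK' : cancel c' c).
Implicit Types (x y v w : 'rV[R]_m) (i j : 'I_m) (G : {set 'I_m * 'I_m}).

Let E i j := sd_edge (c i) (c j).
Let D i j := sd_cap (c i) (c j).

Definition cell G : set 'rV[R]_m := [set v |
  (forall i j, E i j -> v 0 i + v 0 j <= D i j) /\
  (forall i j, (i, j) \in G -> v 0 i + v 0 j = D i j)].

(** Requiring every index to occur in a pair of [G] makes all points of the cell tight, hence
    members of the span. *)
Definition cell_index G :=
  (forall i j, (i, j) \in G -> E i j) /\ forall i, exists j, (i, j) \in G.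

Definition cells : set (set 'rV[R]_m) :=
  [set P | exists G, [/\ cell_index G, P = cell G & P !=set0]].


Lemma cell_midpoint G x y : cell G x -> cell G y -> cell G (2^-1 *: (x + y)).
Proof.
move=> [x1 x2] [y1 y2]; split => i j h; rewrite !mxE.
  by have := x1 _ _ h; have := y1 _ _ h; lra.
by have := x2 _ _ h; have := y2 _ _ h; lra.
Qed.

Lemma cell_polyhedron G : cell_index G -> convex_polyhedron (cell G).
Proof.
move=> [GE _].
(* The flag [true] encodes the upper bound on an edge, [false] the reverse inequality on a pair of
   [G]; the remaining indices encode [0 <= 0]. *)
pose a (t : 'I_m * 'I_m * bool) : 'rV[R]_m :=
  if t.2 then (if `[< E t.1.1 t.1.2 >] then pairv t.1.1 t.1.2 else 0)
  else (if t.1 \in G then - pairv t.1.1 t.1.2 else 0).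
pose b (t : 'I_m * 'I_m * bool) :=
  if t.2 then (if `[< E t.1.1 t.1.2 >] then D t.1.1 t.1.2 else 0)
  else (if t.1 \in G then - D t.1.1 t.1.2 else 0).
rewrite (_ : cell G = [set x | forall t, dotv (a t) x <= b t]).
  exact: convex_polyhedron_fin.
apply/seteqP; split => [x [h1 h2] [[i j] []]|x h]; rewrite /a /b /=.
- by case: asboolP => [/h1|_]; rewrite ?dotv_pairv// dotv0l.
- by case: ifP => [/h2|_]; rewrite ?dotvNl ?dotv_pairv ?dotv0l// => ->.
split=> i j ij; first by have := h (i, j, true); rewrite /a /b /= asboolT// dotv_pairv.
apply/eqP; rewrite eq_le; apply/andP; split.
  by have := h (i, j, true); rewrite /a /b /= asboolT ?dotv_pairv//; exact: GE.
by have := h (i, j, false); rewrite /a /b /= ij dotvNl dotv_pairv lerN2.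
Qed.

Lemma cells_finite : finite_set cells.
Proof.
apply: (@sub_finite_set _ _ (range cell)).
  by move=> P [G [_ -> _]]; exists G.
exact: finite_image.
Qed.

(** The sum of the constraints in [G'] is a supporting functional, and equality in the sum forces
    equality in each constraint. *)
Lemma cell_inter_face G G' : cell_index G' ->
  face (cell G `&` cell G') (cell G).
Proof.
move=> [GE' _].
exists (\sum_(p in G') pairv p.1 p.2), (\sum_(p in G') D p.1 p.2).
split=> [x [h1 h2] /=|].
  rewrite dotv_suml; apply: ler_sum => -[i j] ij; rewrite dotv_pairv /=.
  exact/h1/GE'.
apply/seteqP; split => x [Gx]; first by
  move=> [h1 h2]; split => //=; rewrite dotv_suml; apply: eq_bigr => -[i j] ij;
  rewrite dotv_pairv /=; exact: h2.
rewrite /= dotv_suml => h; split => //; have [h1 h2] := Gx; split => // i j ij.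
have : \sum_(p in G') (D p.1 p.2 - (x 0 p.1 + x 0 p.2)) = 0.
  rewrite sumrB -h -sumrB big1// => p _; rewrite dotv_pairv; exact: subrr.
move=> /psumr_eq0P => /(_ _ (i, j) ij) /= H.
apply/eqP; rewrite eq_sym -subr_eq0; apply/eqP/H => -[k l] kl /=.
by rewrite subr_ge0; exact/h1/GE'.
Qed.

(** [G'] collects the edges that are tight on all of [F]; the point at issue is that no other
    condition cuts out the face. *)
Lemma cell_face G F : cell_index G -> face F (cell G) -> F !=set0 ->
  exists2 G', cell_index G' & F = cell G'.
Proof.
move=> [GE Gc] [a [b [Pab ->]]] [x0 Fx0].
set F' := _ `&` _ in Fx0 *.
pose G' : {set 'I_m * 'I_m} := finset (fun p =>
  `[< E p.1 p.2 /\ forall x, F' x -> x 0 p.1 + x 0 p.2 = D p.1 p.2 >]).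
have G'P i j : (i, j) \in G' <-> E i j /\ forall x, F' x -> x 0 i + x 0 j = D i j.
  by rewrite finset.in_set; split => [/asboolP//|h]; apply/asboolP.
have GG' i j : (i, j) \in G -> (i, j) \in G'.
  by move=> ij; apply/G'P; split; [exact: GE | move=> x [[_ h] _]; exact: h].
exists G'.
  split; first by move=> i j /G'P[].
  by move=> i; have [j ij] := Gc i; exists j; exact: GG'.
apply/seteqP; split => [x Fx|y [y1 y2]].
  have [[x1 x2] _] := Fx; split => // i j /G'P[_]; exact.
split; first by split => // i j /GG'; exact: y2.
(* A point [x] of the relative interior of the face: [y] belongs to the
   supporting hyperplane because the segment from [y] to [x] can be prolonged
   beyond [x] inside the cell. *)
have [x Fx xs] : exists2 x, F' x & forall i j, E i j -> (i, j) \notin G' ->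
    x 0 i + x 0 j < D i j.
  suff [x Fx xs] : exists2 x, F' x & forall p, p \in enum {: 'I_m * 'I_m} ->
      E p.1 p.2 -> p \notin G' -> x 0 p.1 + x 0 p.2 < D p.1 p.2.
    by exists x => // i j; apply: (xs (i, j)); rewrite mem_enum.
  elim: (enum _) => [|[i j] s [x Fx xs]]; first by exists x0.
  have [[Eij nij]|nE] := pselect (E i j /\ (i, j) \notin G'); last first.
    exists x => // p; rewrite inE => /predU1P[-> h1 h2|]; last exact: xs.
    by case: nE.
  have [z Fz zs] : exists2 z, F' z & z 0 i + z 0 j < D i j.
    apply: contrapT => nz; move/negP: nij; apply; apply/G'P; split => // z Fz.
    have [[z1 _] _] := Fz; apply/eqP; rewrite eq_le z1//= leNgt; apply/negP => h.
    by apply: nz; exists z.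
  (* The midpoint gains strictness on the edge [(i, j)] from [z] and keeps that of [x] on the edges
     already treated. *)
  exists (2^-1 *: (x + z)).
    split; first by apply: cell_midpoint; [case: Fx | case: Fz].
    by case: Fx => _ /= ex; case: Fz => _ /= ez; rewrite dotvZr dotvDr ex ez; lra.
  have [[x1 _] _] := Fx; have [[z1 _] _] := Fz.
  move=> p; rewrite inE => /predU1P[-> _ _|ps Ep np]; rewrite !mxE /=.
    by have := x1 _ _ Eij; lra.
  by have := xs p ps Ep np; have := z1 _ _ Ep; lra.
have [t t0 ht] : exists2 t : R, 0 < t & forall i j, E i j ->
    x 0 i + x 0 j + t * (x 0 i + x 0 j - (y 0 i + y 0 j)) <= D i j.
  pose Q (p : 'I_m * 'I_m) t := E p.1 p.2 ->
    x 0 p.1 + x 0 p.2 + t * (x 0 p.1 + x 0 p.2 - (y 0 p.1 + y 0 p.2)) <= D p.1 p.2.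
  suff [d d0 hd] : exists2 d : R, 0 < d & forall p t, 0 < t <= d -> Q p t.
    by exists d => // i j; apply: (hd (i, j)); rewrite d0 lexx.
  apply: fin_pos_min => -[i j]; rewrite /Q /=.
  have [Eij|nE] := pselect (E i j); last by exists 1.
  have [ijG|ijG] := boolP ((i, j) \in G').
    exists 1 => // t _ _; have [_ /(_ _ Fx) ->] := (G'P i j).1 ijG.
    by rewrite y2// subrr mulr0 addr0.
  have s0 := xs i j Eij ijG; set u := x 0 i + x 0 j in s0 *.
  set w := y 0 i + y 0 j; pose k : R := `|u - w| + 1.
  have k0 : 0 < k by rewrite ltr_wpDl.
  exists ((D i j - u) / k); first by rewrite divr_gt0// subr_gt0.
  move=> t /andP[t0 td] _; rewrite ler_pdivlMr// in td.
  have : t * (u - w) <= t * k.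
    apply: ler_wpM2l; first exact: ltW.
    by rewrite (le_trans (ler_norm _))// lerDl.
  by lra.
pose w := x + t *: (x - y).
have Pw : cell G w.
  have [[x1 x2] _] := Fx; split => i j h; rewrite !mxE; have hE : E i j by [|exact: GE].
    by have := ht i j hE; lra.
  by have := x2 i j h; have := y2 i j (GG' _ _ h); nra.
have := Pab _ Pw; have : dotv a y <= b.
  by apply: Pab; split => // i j /GG'; exact: y2.
have [_ /= xb] := Fx; rewrite /w /= dotvDr dotvZr dotvDr xb.
have -> : - y = (-1) *: y by rewrite scaleN1r.
rewrite dotvZr => h1 h2; apply/eqP; rewrite eq_le h1 /=.
by have := t0; nra.
Qed.

Lemma cells_complex : polyhedral_complex cells.
Proof.
split; first exact: cells_finite.
- by move=> P [G [Gi -> P0]]; split => //; exact: cell_polyhedron.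
- move=> P F [G [Gi -> _]] fF F0; have [G' G'i FE] := cell_face Gi fF F0.
  by exists G'; rewrite -FE.
- move=> P Q [G [Gi -> _]] [G' [G'i -> _]] _; split; first exact: cell_inter_face.
  by rewrite setIC; exact: cell_inter_face.
Qed.

Lemma tight_fin (f : tspan S) i : exists2 j, E i j & f (c i) + f (c j) = D i j.
Proof.
apply: contrapT => nj.
pose Q (j : 'I_m) (t : R) := E i j -> f (c i) + f (c j) + t < D i j.
have [d d0 hd] : exists2 d : R, 0 < d & forall j t, 0 < t <= d -> Q j t.
  apply: fin_pos_min => j; rewrite /Q.
  have [Eij|nE] := pselect (E i j); last by exists 1.
  have s0 : f (c i) + f (c j) < D i j.
    rewrite lt_neqAle tval_adm// andbT; apply/eqP => h; apply: nj.
    by exists j.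
  exists ((D i j - (f (c i) + f (c j))) / 2); first by lra.
  by move=> t /andP[t0 td] _; lra.
have [y xy hy] := tval_tight f (c i) d0.
have := hd (c' y) d; rewrite d0 lexx /Q /E /D cK' => /(_ isT xy); lra.
Qed.

Lemma linf_span : linf_polyhedral_complex (tspan S).
Proof.
exists m, cells, (fun f : tspan S => \row_j f (c j)); split.
- exact: cells_complex.
- move=> f g; rewrite -[LHS]/(mx_norm _) mx_normrE.
  apply/eqP; rewrite eq_le; apply/andP; split.
    apply: bigmax_le; first exact: mdist_ge0.
    by move=> [i j] _; rewrite !mxE; exact: tmdist_ge.
  apply: tmdist_le => x.
  apply: le_trans (le_bigmax _ _ (0, c' x)) => /=.
  by rewrite !mxE cK'.
- apply/seteqP; split => [_ [f _ <-]|v [P [G [[GE Gc] -> _]] [v1 v2]]].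
    pose G : {set 'I_m * 'I_m} := finset (fun p =>
      `[< E p.1 p.2 /\ f (c p.1) + f (c p.2) = D p.1 p.2 >]).
    have GP i j : (i, j) \in G <-> E i j /\ f (c i) + f (c j) = D i j.
      by rewrite finset.in_set; split => [/asboolP//|h]; apply/asboolP.
    have Gf : cell G (\row_j f (c j)).
      split=> i j; rewrite !mxE; first exact: tval_adm.
      by move=> /GP[].
    exists (cell G) => //; exists G; split => //; last by eexists; exact: Gf.
    split; first by move=> i j /GP[].
    by move=> i; have [j ij h] := tight_fin f i; exists j; apply/GP.
  pose f (s : S) : R := v 0 (c' s).
  have fb : bounded f.
    exists (\sum_j `|v 0 j|) => s; rewrite (bigD1 (c' s))//= lerDl.
    by rewrite sumr_ge0.
  have fa : admissible f.
    by move=> s t st; have := v1 (c' s) (c' t); rewrite /E /D !cK'; exact.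
  have ft : tight f.
    move=> s e e0; have [j sj] := Gc (c' s); exists (c j).
      by have := GE _ _ sj; rewrite /E cK'.
    by have := v2 _ _ sj; rewrite /D cK' /f cK => ->; rewrite lerDl ltW.
  exists (TSpan fb fa ft) => //; apply/rowP => j; rewrite mxE /f /= /f cK//.
Qed.

End LinfComplex.

(** * Finite nets and Gromov-Hausdorff limits *)

(** Approximating a point [y] near the rim of the ball directly could leave the ball. Instead one
    approximates, up to [e / 2], the point at distance [e / 2] before [y] on a geodesic from [x]. *)
Lemma gh_of_embeddings (R : realType) (X_ : nat -> metricType R) (x_ : forall n, X_ n)
    (X : metricType R) (x : X) (phi : forall n, X_ n -> X) :
  (forall n, proper_space (X_ n) /\ geodesic_space (X_ n)) ->
  proper_space X -> geodesic_space X ->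
  (forall n, isometric_embedding (phi n)) -> (forall n, phi n (x_ n) = x) ->
  (forall r e : R, 0 < e -> exists n0, forall n, (n0 <= n)%N ->
    forall y, mdist x y <= r -> exists z, mdist (phi n z) y <= e) ->
  pointed_gh_cvg x_ x.
Proof.
move=> hX_ pX gX iso base approx; split=> // r e r0 e0.
have e2 : 0 < e / 2 by lra.
have [n0 hn0] := approx r _ e2; exists n0 => n n0n.
have dx z : mdist x (phi n z) = mdist (x_ n) z by rewrite -(base n) iso.
exists (phi n) => //; split.
- by move=> z; rewrite /cball /= dx.
- apply: (@le_lt_trans _ _ 0%:E); last by rewrite lte_fin.
  apply: ge_ereal_sup => _ [u _ [v _ <-]].
  by rewrite iso subrr normr0.
move=> y; rewrite /cball /= => yr.
have [ye|ye] := leP (mdist x y) (e / 2).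
  exists (x_ n); first by rewrite /cball /= mdistxx ltW.
  by rewrite /cball /= base; lra.
have [c [cg c0 cd]] := gX x y.
have d0 := mdist_ge0 x y.
have cE s t : 0 <= s <= mdist x y -> 0 <= t <= mdist x y -> mdist (c s) (c t) = `|s - t|.
  by move=> hs ht; apply: cg; rewrite inE /= in_itv.
pose s := mdist x y - e / 2.
have hs : 0 <= s <= mdist x y by apply/andP; rewrite /s; lra.
have h0 : 0 <= (0 : R) <= mdist x y by rewrite lexx.
have hd : 0 <= mdist x y <= mdist x y by rewrite d0 lexx.
have xs : mdist x (c s) = s.
  by rewrite -{1}c0 cE// sub0r normrN ger0_norm//; case/andP: hs.
have sy : mdist (c s) y = e / 2.
  by rewrite -{1}cd cE// distrC /s opprB addrC subrK ger0_norm// ltW.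
have [|z hz] := hn0 n n0n (c s); first by rewrite xs /s; lra.
exists z; rewrite /cball /=.
  rewrite -dx; have := metric_triangle x (c s) (phi n z).
  by rewrite (metric_sym (c s)) xs /s; lra.
by have := metric_triangle (phi n z) (c s) y; lra.
Qed.

Lemma ultra_fin (m : nat) (F : set_system 'I_m) : UltraFilter F ->
  exists i, F [set j | j = i].
Proof.
move=> UF; apply: contrapT => /forallNP nF.
have FN : F [set j | forall i, j <> i].
  have := @filter_forall _ _ (fun i => [set j : 'I_m | j <> i]) F _.
  by apply => i; have [|//] := in_ultra_setVsetC [set j | j = i] UF => /nF.
by have [j /(_ j)] := filter_ex FN.
Qed.

Lemma uniq_tnth_inj (T : eqType) (s : seq T) : uniq s ->
  injective (fun j : 'I_(size s) => tnth (in_tuple s) j).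
Proof. by move=> us; apply/(@tuple_uniqP _ _ (in_tuple s)). Qed.

Lemma fin_enum (T : Type) (I : finType) (f : I -> T) :
  exists (m : nat) (a : 'I_m -> T), [/\ injective a,
    forall i, exists j, a j = f i & forall j, exists i, a j = f i].
Proof.
pose s : seq {classic T} := undup [seq (f i : {classic T}) | i <- enum I].
have si i : (f i : {classic T}) \in s by rewrite mem_undup map_f// mem_enum.
exists (size s), (fun j => tnth (in_tuple s) j); split.
- exact/uniq_tnth_inj/undup_uniq.
- by move=> i; have /(tnthP (in_tuple s))[j ->] := si i; exists j.
- move=> j; have : tnth (in_tuple s) j \in s by exact: mem_tnth.
  by rewrite mem_undup => /mapP[i _ ->]; exists i.
Qed.

Section FiniteNet.
Context {R : realType}.

Record finite_net (Z : antipodal R) := FiniteNet {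
  fn_size : nat;
  fn_pt :> 'I_fn_size -> Z;
  fn_inj : injective fn_pt;
  fn_anti : forall i, exists j, rho (fn_pt i) (fn_pt j) = 1;
  fn_four : (4 <= fn_size)%N
}.

Variables (Z : antipodal R) (N : finite_net Z).
Notation I := 'I_(fn_size N).

Let rhoN (i j : I) : R := rho (N i) (N j).

Let unifN e : 0 < e -> exists2 d, 0 < d &
  forall i i', rhoN i i' <= d -> forall j, `|rhoN i j - rhoN i' j| <= e.
Proof.
by move=> e0; have [d d0 hd] := rho_unif Z e0; exists d => // i i' h j; exact: hd.
Qed.

Let ultraN (F : set_system I) : UltraFilter F ->
  exists i, forall e, 0 < e -> F [set j | rhoN i j <= e].
Proof.
move=> UF; have [i Fi] := ultra_fin UF; exists i => e e0.
by apply: filterS Fi => j /= ->; rewrite /rhoN rhoxx ltW.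
Qed.

Let fourN : (`I_4 #<= [set: I])%card.
Proof.
apply: (@card_le_trans _ _ _ (`I_(fn_size N))).
  by apply: subset_card_le => k /= k4; apply: leq_trans k4 (fn_four N).
by have := @card_II (fn_size N); rewrite card_eq_le => /andP[].
Qed.

Definition net_antipodal : antipodal R :=
  @Antipodal R I rhoN (fun i j => rho_ge0 _ _) (fun i j => rho_le1 _ _)
    (fun i j => rhoC _ _) (fun i => rhoxx _)
    (fun i j e => fn_inj (rho_eq0 e)) (@fn_anti Z N) unifN ultraN fourN.

Notation T := (tspan (ap_span Z)).
Notation TN := (tspan (ap_span net_antipodal)).
Implicit Types (f g : TN) (h : T).

Let ext f : ap_span Z -> R := fun x =>
  if pselect (exists i, N i = x) is left k then f (projT1 (cid k)) else - nrm f.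

Let extE f i : ext f (N i) = f i.
Proof.
rewrite /ext; case: pselect => [k|[]]; last by exists i.
by case: cid => j /= /fn_inj ->.
Qed.

Let extN f x : ~ (exists i, N i = x) -> ext f x = - nrm f.
Proof. by rewrite /ext; case: pselect. Qed.

Let ext_bounded f : bounded (ext f).
Proof.
exists (nrm f) => x; have [[i <-]|nx] := pselect (exists i, N i = x).
  by rewrite extE nrm_ge.
by rewrite extN// normrN ger0_norm ?nrm_ge0.
Qed.

Let ext_adm f : admissible (ext f).
Proof.
move=> x y /= xy; have l0 : ln (rho x y) <= 0 by rewrite ln_le0// rho_le1.
have n0 := nrm_ge0 f.
have [[i ix]|nx] := pselect (exists i, N i = x);
  have [[j jy]|ny] := pselect (exists j, N j = y).
- have ij : i <> j by move=> ij; apply: xy; rewrite -ix -jy ij.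
  by rewrite -ix -jy !extE; exact: (ap_adm f ij).
- have -> : ext f x = f i by rewrite -ix extE.
  by rewrite extN//; have := nrm_bound f i; lra.
- have -> : ext f y = f j by rewrite -jy extE.
  by rewrite extN//; have := nrm_bound f j; lra.
- by rewrite !extN//; lra.
Qed.

(* Jumping down to [- nrm f] off the net keeps the extension 1-Lipschitz in [f]
   and admissible, because [f x <= nrm f]. *)
Definition net_emb f : T := retract (ext_bounded f) (ext_adm f).

(** Retracting cannot raise a value on the net, because a partner of [i] for [f] already lies in the
    net. *)
Lemma net_embE f i : net_emb f (N i) = f i.
Proof.
apply/eqP; rewrite eq_le; apply/andP; split; last first.
  by rewrite -extE; exact: retr_ge (@ext_adm f).
have [j ij hij] := ap_partner f i.
have ij' : N i <> N j by move=> /fn_inj.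
have := ap_adm (net_emb f) ij'.
have := retr_ge (N j) (@ext_adm f); rewrite extE /=.
have -> : ln (rho (N i) (N j)) = ln (@rho R net_antipodal i j) by [].
lra.
Qed.

Lemma net_emb_iso : isometric_embedding net_emb.
Proof.
move=> f g; apply/eqP; rewrite eq_le; apply/andP; split; last first.
  by apply: tmdist_leB => i; rewrite -!net_embE; exact: tmdist_geB.
apply: retract_lip => x; have [[i <-]|nx] := pselect (exists i, N i = x).
  by rewrite !extE; exact: tmdist_ge.
rewrite !extN// opprK addrC /nrm.
have := metric_triangle (tzero net_antipodal) f g.
have := metric_triangle (tzero net_antipodal) g f.
by rewrite (metric_sym g f) ler_norml => ? ?; apply/andP; lra.
Qed.

Lemma net_emb0 : net_emb (tzero net_antipodal) = tzero Z.
Proof.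
apply: mdist_positivity; apply/eqP; rewrite eq_le mdist_ge0 andbT.
rewrite -[X in mdist _ X](retract_id (tval_bounded (tzero Z)) (tval_adm (tzero Z))).
apply: retract_lip => x; have [[i <-]|nx] := pselect (exists i, N i = x).
  by rewrite extE /= subrr normr0.
by rewrite (_ : tzero Z x = 0)// subr0 extN// normrN /nrm mdistxx normr0.
Qed.

Let res h : ap_span net_antipodal -> R := fun i => h (N i).

Let res_bounded h : bounded (res h).
Proof. by exists (nrm h) => i; exact: nrm_ge. Qed.

Let res_adm h : admissible (res h).
Proof.
by move=> i j /= ij; apply: (ap_adm h) => /fn_inj.
Qed.

(** The restriction of [h] to the net must be retracted, as partners for [h] may lie off the net. *)
Definition net_res h : TN := retract (res_bounded h) (res_adm h).

Lemma net_res_ge h i : h (N i) <= net_res h i.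
Proof. exact: retr_ge (@res_adm h). Qed.

Lemma net_res_le h i j : i <> j ->
  net_res h i <= - 2 * ln (rho (N i) (N j)) - h (N j).
Proof. by move=> ij; exact: (@retr_le_cap _ _ _ i j (@res_adm h)). Qed.

End FiniteNet.

Section NetDensity.
Context {R : realType} (Z : antipodal R).

(** A partner for [h] of a net point is close to some net point, so retracting the restriction
    raises it by at most [2 * e4]. Equicontinuity of both functions carries the estimate off the
    net, at a cost of [e4] each. *)
Lemma net_dense (r e : R) : 0 < e -> exists2 d, 0 < d &
  forall N : finite_net Z, (forall x, exists i, rho (N i) x <= d) ->
  forall h : tspan (ap_span Z), nrm h <= r ->
  exists f, mdist (net_emb (N := N) f) h <= e.
Proof.
move=> e0; pose e4 := e / 4; have e40 : 0 < e4 by rewrite /e4; lra.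
have [d1 d10 hd1] := tspan_equicontinuous Z (r + e) e40.
pose k := expR (- r); have k0 : 0 < k := expR_gt0 _.
pose n := Num.min (k / 2) (k * e4 / 4).
have n0 : 0 < n by rewrite lt_min !divr_gt0// mulr_gt0.
have nk : n <= k / 2 by rewrite ge_min lexx.
have nk' : n <= k * e4 / 4 by rewrite ge_min lexx orbT.
have [d2 d20 hd2] := rho_unif Z n0.
exists (Num.min d1 d2); first by rewrite lt_min d10.
move=> N net h hr.
have bh z : `|h z| <= r + e by have := nrm_ge h z; lra.
have near i : net_res N h i <= h (N i) + 2 * e4.
  have [y xy hy] := ap_partner h (N i).
  have [j] := net y; rewrite le_min => /andP[jy1 jy2].
  have xy0 := rho_gt0 xy.
  have ry : k <= rho (N i) y.
    rewrite -(lnK xy0) ler_expR; have := nrm_bound h (N i); have := nrm_bound h y.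
    lra.
  have := hd2 _ _ jy2 (N i); rewrite (rhoC (N j)) (rhoC y) ler_norml => /andP[u1 u2].
  have xj0 : 0 < rho (N i) (N j) by lra.
  have ij : i <> j by move=> ij; move: xj0; rewrite ij rhoxx ltxx.
  have := net_res_le h ij; have := hd1 _ _ jy1 h bh; rewrite ler_norml => /andP[w1 w2].
  have := ler_lnB xy0 xj0.
  have : rho (N i) y / rho (N i) (N j) - 1 <= e4 / 2.
    rewrite lerBlDr ler_pdivrMr//; have : k / 2 <= rho (N i) (N j) by lra.
    nra.
  by lra.
exists (net_res N h).
have bf z : `|net_emb (net_res N h) z| <= r + e.
  apply: (le_trans (nrm_ge _ _)); rewrite /nrm -(net_emb0 N) net_emb_iso -/(nrm _).
  apply: nrm_le => i; have := near i; have := net_res_ge h i; have := nrm_bound h (N i).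
  by rewrite /e4 => *; rewrite ler_norml; apply/andP; lra.
apply: tmdist_le => x; have [i] := net x; rewrite le_min => /andP[ix _].
have := hd1 _ _ ix h bh; have := hd1 _ _ ix _ bf; rewrite net_embE.
have := near i; have := net_res_ge h i; rewrite /e4 !ler_norml.
by move=> ? ? /andP[? ?] /andP[? ?]; apply/andP; lra.
Qed.

Lemma net_exists (d : R) : 0 < d ->
  exists N : finite_net Z, forall x, exists i, rho (N i) x <= d.
Proof.
move=> d0; have [m0 [a0 ha0]] := ap_net Z d0.
have [g ginj] := card4_inj (ap_four Z).
pose anti (x : Z) := projT1 (cid (rho_antipode x)).
have antiP x : rho x (anti x) = 1 := projT2 (cid (rho_antipode x)).
pose b (s : 'I_m0 + 'I_4) := match s with inl i => a0 i | inr k => g k end.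
(* Points are listed in antipodal pairs, so no antipodes of antipodes have to be added. *)
pose f (s : ('I_m0 + 'I_4) * bool) := if s.2 then anti (b s.1) else b s.1.
have [m [a [ainj af fa]]] := fin_enum f.
have aanti j : exists k, rho (a j) (a k) = 1.
  have [[s t] sE] := fa j; have [k kE] := af (s, ~~ t); exists k.
  rewrite sE kE /f /=; case: t {sE kE} => /=; last exact: antiP.
  by rewrite rhoC antiP.
have m4 : (4 <= m)%N.
  pose u (k : 'I_4) := projT1 (cid (af (inr k, false))).
  have uE k : a (u k) = g k := projT2 (cid (af (inr k, false))).
  have uinj : injective u by move=> k l kl; apply: ginj; rewrite -!uE kl.
  by have := leq_card u uinj; rewrite !card_ord.
exists (FiniteNet ainj aanti m4) => x /=.
have [i hi] := ha0 x; have [j jE] := af (inl i, false); exists j.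
by rewrite jE.
Qed.

End NetDensity.

(** * Hyperbolicity for a finite boundary *)

Section FiniteHyperbolic.
Context {R : realType}.

(** In products at [o], the claim reads [(x|z) + (y|w) >= min ((x|y) + (z|w), (y|z) + (x|w)) - 2
    delta]; each term on the left costs one [delta]. *)
Lemma hyperbolic_basepoint (X : metricType R) (o : X) (delta : R) : 0 <= delta ->
  (forall x y z, Num.min (gromov_product o x y) (gromov_product o y z) - delta
    <= gromov_product o x z) -> gromov_hyperbolic X.
Proof.
move=> d0 h; exists (2 * delta); first by lra.
have h' x y z : gromov_product o x y - delta <= gromov_product o x z \/
    gromov_product o y z - delta <= gromov_product o x z.
  by have := h x y z; rewrite lerBlDr ge_min => /orP[]; [left|right]; lra.
have gC x y : gromov_product o x y = gromov_product o y x.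
  by rewrite /gromov_product (metric_sym x y); lra.
move=> w x y z.
have gE u v : gromov_product w u v = gromov_product o u v + mdist o w
    - gromov_product o w u - gromov_product o w v.
  rewrite /gromov_product (metric_sym o w) (metric_sym u w) (metric_sym v w); lra.
have h1 := h' x y z; have h2 := h' x w z; have h3 := h' y x w; have h4 := h' y z w.
rewrite lerBlDr ge_min !gE.
move: h1 h2 h3 h4; rewrite !(gC x w) !(gC y x) !(gC z w) !(gC y w).
rewrite !(gC w x) !(gC w y) !(gC w z) => h1 h2 h3 h4.
have [//|n1] /= := leP (gromov_product o x y + mdist o w - gromov_product o x w
  - gromov_product o y w) _.
rewrite leNgt; apply/negP => n2.
by case: h1; case: h2; case: h3; case: h4; lra.
Qed.

Variables (Z : antipodal R) (n : nat) (a : 'I_n -> Z).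
Hypothesis a_onto : forall x, exists i, a i = x.
Notation T := (tspan (ap_span Z)).

Lemma finite_log_bound : exists2 M : R, 0 <= M & forall x y : Z, x <> y -> - ln (rho x y) <= M.
Proof.
have l0 (x y : Z) : 0 <= - ln (rho x y) by rewrite oppr_ge0 ln_le0// rho_le1.
exists (\sum_i \sum_j - ln (rho (a i) (a j))).
  by apply: sumr_ge0 => i _; apply: sumr_ge0.
move=> x y _; have [i <-] := a_onto x; have [j <-] := a_onto y.
rewrite (bigD1 i)//= (bigD1 j)//= -addrA lerDl addr_ge0//; first exact: sumr_ge0.
by apply: sumr_ge0 => k _; exact: sumr_ge0.
Qed.

(** Products at [tzero Z] behave as in a star with one leg for each point of [Z]: at most [M] when
    the functions have different maximum points, and at least the smaller norm minus [M] when they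
    share one. *)
Lemma finite_hyperbolic : gromov_hyperbolic T.
Proof.
have [M M0 hM] := finite_log_bound.
have gpE f g : gromov_product (tzero Z) f g = (nrm f + nrm g - mdist f g) / 2.
  by rewrite /gromov_product /nrm (metric_sym f (tzero Z)) (metric_sym g (tzero Z)).
have gp0 f g : 0 <= gromov_product (tzero Z) f g.
  rewrite gpE; have := metric_triangle f (tzero Z) g.
  rewrite (metric_sym f (tzero Z)) -/(nrm f) -/(nrm g).
  lra.
have gpl f g : gromov_product (tzero Z) f g <= nrm f.
  rewrite gpE; have := metric_triangle (tzero Z) f g; rewrite -/(nrm f) -/(nrm g); lra.
have gpr f g : gromov_product (tzero Z) f g <= nrm g.
  rewrite gpE; have := metric_triangle (tzero Z) g f; rewrite -/(nrm f) -/(nrm g).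
  rewrite (metric_sym g); lra.
have far (f g : T) x y : f x = nrm f -> g y = nrm g -> x <> y ->
    gromov_product (tzero Z) f g <= M.
  move=> fx gy xy; have := hM _ _ xy; have := ap_adm g xy.
  by rewrite gpE; have := tmdist_geB f g x; lra.
have close (f g : T) x : f x = nrm f -> g x = nrm g ->
    Num.min (nrm f) (nrm g) - M <= gromov_product (tzero Z) f g.
  move=> fx gx; have [y hy] := tmdist_attain f g; rewrite gpE -hy lerBlDr.
  have [<-|xy] := pselect (x = y).
    by rewrite fx gx ge_min; apply/orP; right; lra.
  have := hM _ _ xy; have := ap_adm f xy; have := nrm_bound g y => /andP[? ?] ? ?.
  by rewrite ge_min; apply/orP; left; lra.
apply: (@hyperbolic_basepoint _ (tzero Z) M) => // f g h.
have [x fx] := nrm_attain f; have [y gy] := nrm_attain g; have [z hz] := nrm_attain h.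
have [xz|xz] := pselect (x = z).
  subst z; apply: le_trans (close f h x fx hz); rewrite lerD2r le_min.
  by rewrite !ge_min gpl gpr orbT.
have [xy|xy] := pselect (x = y).
  have yz : y <> z by rewrite -xy.
  rewrite lerBlDr ge_min; apply/orP; right.
  by have := far g h y z gy hz yz; have := gp0 f h; lra.
rewrite lerBlDr ge_min; apply/orP; left.
by have := far f g x y fx gy xy; have := gp0 f h; lra.
Qed.

Lemma finite_gp_boundary : finite_set [set: gp_boundary (ap_gp Z)].
Proof.
apply: (@sub_finite_set _ _ (range (fun i => to_bd (a i)))).
  by move=> xi _; have [i ai] := a_onto (bd_pt (val xi)); exists i; rewrite // ai to_bdK.
exact: finite_image.
Qed.

End FiniteHyperbolic.

Lemma maximal_gp_limit (R : realType) (X : gp_space R) : maximal_gp_space X ->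
  exists (X_ : nat -> gp_space R) (x_ : forall n, X_ n) (x : X),
    (forall n, [/\ linf_polyhedral_complex (X_ n), maximal_gp_space (X_ n),
                   gromov_hyperbolic (X_ n) & finite_set [set: gp_boundary (X_ n)]]) /\
    pointed_gh_cvg x_ x.
Proof.
(* A base point of [X] is found near an ideal point, by density. *)
move=> mX; have [c _] := card4_inj (gp_boundary_four X).
have [G UG _] := gp_near_emb (val (c ord0)); have [p0 _] := filter_ex (@filterT _ G _).
have [F Fi Fonto] := maximal_onto p0 mX.
pose Z := bd_antipodal p0.
have d0 n : 0 < n.+1%:R^-1 :> R by rewrite invr_gt0.
pose N n := projT1 (cid (net_exists Z (d0 n))).
have NP n : forall x, exists i, rho (N n i) x <= n.+1%:R^-1 := projT2 (cid (net_exists Z (d0 n))).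
have onto n (x : net_antipodal (N n)) : exists i : 'I_(fn_size (N n)), i = x by exists x.
exists (fun n => ap_gp (net_antipodal (N n))).
exists (fun n => tzero (net_antipodal (N n))), (F (tzero Z)).
split.
  move=> n; split.
  - exact: (@linf_span R (ap_span (net_antipodal (N n))) (fn_size (N n)) id id).
  - exact: (finite_maximal (onto n)).
  - exact: (finite_hyperbolic (onto n)).
  - exact: (finite_gp_boundary (onto n)).
apply: (@gh_of_embeddings R (fun n => ap_gp (net_antipodal (N n))) _ X _
  (fun n f => F (net_emb f))).
- by move=> n; split; [exact: ap_proper | exact: tspan_geodesic].
- exact: gp_proper.
- exact: gp_geodesic.
- by move=> n f g; rewrite Fi net_emb_iso.
- by move=> n; rewrite net_emb0.
move=> r e e0; have [d dpos hd] := net_dense Z r e0.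
exists (Num.truncn d^-1) => n dn y ry; have [h hy] := Fonto y.
have hr : nrm h <= r by rewrite /nrm -(Fi (tzero Z)) hy.
have [|f hf] := hd (N n) _ h hr; last by exists f; rewrite -hy Fi.
move=> x; have [i hi] := NP n x; exists i; apply: (le_trans hi).
rewrite -[leRHS]invrK lef_pV2 ?posrE ?invr_gt0//.
by rewrite ltW// (lt_le_trans (truncnS_gt _))// ler_nat.
Qed.

(** * Injective spaces *)

Lemma proper_net (R : realType) (X : metricType R) (p : X) (r e : R) :
  proper_space X -> 0 < e -> exists (m : nat) (b : 'I_m.+1 -> X), b ord0 = p /\
    forall y, mdist p y <= r -> exists i, mdist (b i) y <= e.
Proof.
move=> pX e0; apply: (@ultra_finite_cover X (cball p r) (fun x y => mdist x y <= e)).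
move=> F UF Fb; have [x _ Fx] := ultra_cvg_compact (f := id) UF (pX p r) Fb.
by exists x; apply: filterS (cvg_mdist_lt _ Fx e0) => y /ltW.
Qed.

Section MetricSpan.
Context {R : realType} (X : metricType R) (m : nat) (b : 'I_m.+1 -> X).

Let edge (i j : 'I_m.+1) := True.
Let cap (i j : 'I_m.+1) : R := - mdist (b i) (b j).
Let capC i j : cap i j = cap j i. Proof. by rewrite /cap metric_sym. Qed.
Let cap_le0 i : exists2 j, edge i j & cap i j <= 0.
Proof. by exists i => //; rewrite /cap mdistxx oppr0. Qed.

Canonical metric_span : span_data R :=
  @SpanData R 'I_m.+1 edge cap (fun _ _ e => e) capC cap_le0 ord0.

Notation T := (tspan metric_span).
Implicit Types f g : T.

Let kur i : metric_span -> R := fun j => - mdist (b i) (b j).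

Let kur_bounded i : bounded (kur i).
Proof.
exists (\sum_j mdist (b i) (b j)) => j.
rewrite /kur normrN ger0_norm ?mdist_ge0// (bigD1 j)//= lerDl.
by apply: sumr_ge0 => k _; exact: mdist_ge0.
Qed.

Let kur_adm i : admissible (kur i).
Proof.
move=> j k _; rewrite /kur /= /cap; have := metric_triangle (b j) (b i) (b k).
by rewrite (metric_sym (b j) (b i)); lra.
Qed.

Let kur_tight i : tight (kur i).
Proof.
move=> j e e0; exists i => //=; rewrite /kur /cap mdistxx (metric_sym (b j)); lra.
Qed.

(** The Kuratowski embedding of the net, with the sign convention of the span. *)
Definition kuratowski i : T := TSpan (kur_bounded i) (kur_adm i) (kur_tight i).

Lemma metric_span_determined : finitely_determined metric_span.
Proof.
move=> r e e0; exists m.+1, id => i; exists i => f _.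
by rewrite subrr normr0 ltW.
Qed.

Lemma kuratowski_ge i j : mdist (b i) (b j) <= mdist (kuratowski i) (kuratowski j).
Proof.
have := tmdist_geB (kuratowski j) (kuratowski i) j.
by rewrite /= /kur mdistxx (metric_sym (kuratowski j)); lra.
Qed.

Lemma kuratowski_le f i : mdist f (kuratowski i) <= - f i.
Proof.
apply: tmdist_leB => j; have := tval_adm f (I : sd_edge i j); rewrite /= /kur /cap; lra.
Qed.

(** A 1-Lipschitz extension of [kuratowski i |-> b i] is isometric: tightness of [f] leaves no room
    for the distance from its image to [b i] to be less than [- f i], and these distances bound the
    distance between images from below. *)
Lemma metric_span_embedding : injective_space X ->
  exists2 F : T -> X, isometric_embedding F & forall i, F (kuratowski i) = b i.
Proof.
move=> iX; pose B : set T := range kuratowski.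
have hB (u : B) : exists i, kuratowski i = val u.
  by case: u => u /= /set_mem[i _ <-]; exists i.
pose h (u : B) := projT1 (cid (hB u)).
have hE (u : B) : kuratowski (h u) = val u := projT2 (cid (hB u)).
have [|F [Fl FE]] := iX T B (fun u => b (h u)).
  by move=> u v; rewrite -!hE; exact: kuratowski_ge.
have Fk i : F (kuratowski i) = b i.
  have iB : B (kuratowski i) by exists i.
  have -> : F (kuratowski i) = b (h (exist (fun u => u \in B) _ (mem_set iB))).
    exact: (FE (exist (fun u => u \in B) _ (mem_set iB))).
  apply: mdist_positivity; apply/eqP; rewrite eq_le mdist_ge0 andbT.
  by rewrite (le_trans (kuratowski_ge _ _))// hE /= mdistxx.
exists F => // f g; apply/eqP; rewrite eq_le Fl /=.
have Fb f' i : mdist (F f') (b i) = - f' i.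
  apply/eqP; rewrite eq_le -{1}(Fk i) (le_trans (Fl _ _)) ?kuratowski_le//=.
  apply/ler_addgt0Pl => e e0; have [j _ hj] := tval_tight f' i e0.
  have := Fl f' (kuratowski j); rewrite Fk; have := kuratowski_le f' j.
  have := metric_triangle (b i) (F f') (b j); rewrite (metric_sym (b i) (F f')).
  by move: hj; rewrite /= /cap; lra.
apply: tmdist_leB => i; have := Fb f i; have := Fb g i.
have := metric_triangle (F g) (F f) (b i); rewrite (metric_sym (F g) (F f)); lra.
Qed.

End MetricSpan.

Lemma injective_limit (R : realType) (X : metricType R) (p : X) :
  injective_space X -> proper_space X -> geodesic_space X ->
  exists (X_ : nat -> metricType R) (x_ : forall n, X_ n),
    (forall n, linf_polyhedral_complex (X_ n)) /\ pointed_gh_cvg x_ p.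
Proof.
move=> iX pX gX.
have d0 n : 0 < n.+1%:R^-1 :> R by rewrite invr_gt0.
pose N n := cid (proper_net p n%:R pX (d0 n)).
pose m n := projT1 (N n).
pose b n : 'I_(m n).+1 -> X := projT1 (cid (projT2 (N n))).
have bP n : b n ord0 = p /\ forall y, mdist p y <= n%:R ->
  exists i, mdist (b n i) y <= n.+1%:R^-1 := projT2 (cid (projT2 (N n))).
pose F n := projT1 (cid2 (metric_span_embedding (b n) iX)).
have Fi n : isometric_embedding (F n) by rewrite /F; case: cid2.
have Fk n i : F n (kuratowski (b n) i) = b n i by rewrite /F; case: cid2.
exists (fun n => tspan (metric_span (b n))), (fun n => kuratowski (b n) ord0); split.
  move=> n; exact: (@linf_span R (metric_span (b n)) (m n).+1 id id).
apply: (@gh_of_embeddings R _ _ X p F) => //.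
- move=> n; split; last exact: tspan_geodesic.
  exact/tspan_proper/metric_span_determined.
- by move=> n; rewrite Fk; have [] := bP n.
move=> r e e0; exists (maxn (Num.truncn r).+1 (Num.truncn e^-1)) => n.
rewrite geq_max => /andP[rn en] y ry.
have [_ /(_ y)[|i hi]] := bP n.
  apply: (le_trans ry); apply: (le_trans (ltW (truncnS_gt _))).
  by rewrite ler_nat.
exists (kuratowski (b n) i); rewrite Fk (le_trans hi)//.
rewrite -[leRHS]invrK lef_pV2 ?posrE ?invr_gt0//.
by rewrite ltW// (lt_le_trans (truncnS_gt _))// ler_nat.
Qed.

Theorem theorem1p8 (R : realType) :
  (forall X : gp_space R, maximal_gp_space X ->
     exists (X_ : nat -> gp_space R) (x_ : forall n, X_ n) (x : X),
       (forall n, [/\ linf_polyhedral_complex (X_ n),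
                      maximal_gp_space (X_ n),
                      gromov_hyperbolic (X_ n) &
                      finite_set [set: gp_boundary (X_ n)]]) /\
       pointed_gh_cvg x_ x) /\
  (forall X : metricType R,
     injective_space X -> good_gromov_hyperbolic X ->
     (`I_4 #<= [set: gromov_boundary X])%card ->
     exists (X_ : nat -> metricType R) (x_ : forall n, X_ n) (x : X),
       (forall n, linf_polyhedral_complex (X_ n)) /\ pointed_gh_cvg x_ x).
Proof.
split; first exact: maximal_gp_limit.
move=> X iX [_ pX gX _ _] /card4_inj[c _].
(* A sequence representing an ideal point supplies a base point in [X]. *)
have [u _ _] := set_valP (c ord0).
have [X_ [x_ h]] := injective_limit (u 0%N) iX pX gX.
by exists X_, x_, (u 0%N).
Qed.
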